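(* Let $1/4<\alpha<1/3$, let $\mathbf X=(X^1,X^2,X^3),\tilde{\mathbf X}=(\tilde X^1,\tilde X^2,\tilde X^3)\in\Omega_\alpha(\mathcal V)$ be level-3 rough paths on $[0,T]$, and let $(Y,Y^\dagger,Y^{\dagger\dagger})\in\mathcal Q^\alpha_{\mathbf X}([0,T],L(\mathcal V,\mathcal W))$ and $(\tilde Y,\tilde Y^\dagger,\tilde Y^{\dagger\dagger})\in\mathcal Q^\alpha_{\tilde{\mathbf X}}([0,T],L(\mathcal V,\mathcal W))$ lie in a bounded set, i.e. for some $M<\infty$ $$|Y_0|+|Y^\dagger_0|+|Y^{\dagger\dagger}_0|+\|(Y,Y^\dagger,Y^{\dagger\dagger})\|_{\mathcal Q^\alpha_{\mathbf X},[0,T]}\le M,\qquad|||\mathbf X|||_{\alpha\text{-hld}}\le M,$$ with the same bounds for $\tilde{\mathbf X}$ and $(\tilde Y,\tilde Y^\dagger,\tilde Y^{\dagger\dagger})$. Define $$(Z,Z^\dagger,Z^{\dagger\dagger}):=\Big(\int_0^\cdot Y\,d\mathbf X,\ Y,\ Y^\dagger\Big)\in\mathcal Q^\alpha_{\mathbf X}([0,T],\mathcal W)$$ and $(\tilde Z,\tilde Z^\dagger,\tilde Z^{\dagger\dagger})$ analogously. Then there is a constant $C_M=C(M,\alpha)>0$ such that $$d_{\mathbf X,\tilde{\mathbf X},3\alpha}(Z,Z^\dagger,Z^{\dagger\dagger};\tilde Z,\tilde Z^\dagger,\tilde Z^{\dagger\dagger})\le C_M\,R\qquad\text{and}\qquad\|Z-\tilde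 Z\|_{\alpha\text{-hld}}\le C_M\,R,$$ where $$R=\rho_\alpha(\mathbf X,\tilde{\mathbf X})+|Y_0-\tilde Y_0|+|Y_0^\dagger-\tilde Y_0^\dagger|+|Y_0^{\dagger\dagger}-\tilde Y_0^{\dagger\dagger}|+T^\alpha d_{\mathbf X,\tilde{\mathbf X},3\alpha}(Y,Y^\dagger,Y^{\dagger\dagger};\tilde Y,\tilde Y^\dagger,\tilde Y^{\dagger\dagger}).$$
   Context: The time horizon $T>0$ ranges in a fixed bounded set; $\mathcal V,\mathcal W$ are Euclidean spaces. $\Delta_T=\{0\le s\le t\le T\}$; $\|\varphi\|_{\eta\text{-hld}}=\sup_{s<t}|\varphi_t-\varphi_s|/(t-s)^\eta$ for paths and $\|\psi\|_{\eta\text{-hld}}=\sup_{s<t}|\psi_{s,t}|/(t-s)^\eta$ for maps on $\Delta_T$. A level-3 rough path $\mathbf X=(X^1,X^2,X^3)\in\Omega_\alpha(\mathcal V)$ is a continuous map from $\Delta_T$ to $\mathcal V\oplus\mathcal V^{\otimes2}\oplus\mathcal V^{\otimes3}$ with $(1,\mathbf X_{s,t})=(1,\mathbf X_{s,u})\otimes(1,\mathbf X_{u,t})$ in the truncated tensor algebra and $|||\mathbf X|||_{\alpha\text{-hld}}:=\sum_{i=1}^3\|X^i\|_{i\alpha\text{-hld}}<\infty$; $\rho_\alpha(\mathbf X,\tilde{\mathbf X})=\sum_{i=1}^3\|X^i-\tilde X^i\|_{i\alpha\text{-hld}}$. For a Euclidean space $\mathcal E$, $(Y,Y^\dagger,Y^{\dagger\dagger})\in\mathcal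 Q^\alpha_{\mathbf X}([0,T],\mathcal E)$ (controlled path) means: $Y,Y^\dagger,Y^{\dagger\dagger}$ are $\alpha$-Hölder paths in $\mathcal E$, $L(\mathcal V,\mathcal E)$, $L(\mathcal V,L(\mathcal V,\mathcal E))\cong L(\mathcal V^{\otimes2},\mathcal E)$ (with $Y^{\dagger\dagger}(a\otimes b)=(Y^{\dagger\dagger}a)b$), and the remainders defined by $Y_t-Y_s=Y^\dagger_sX^1_{s,t}+Y^{\dagger\dagger}_sX^2_{s,t}+Y^\sharp_{s,t}$, $Y^\dagger_t-Y^\dagger_s=Y^{\dagger\dagger}_sX^1_{s,t}+Y^{\sharp\sharp}_{s,t}$ satisfy $\|Y^\sharp\|_{3\alpha\text{-hld}}<\infty$, $\|Y^{\sharp\sharp}\|_{2\alpha\text{-hld}}<\infty$. The seminorm is $\|(Y,Y^\dagger,Y^{\dagger\dagger})\|_{\mathcal Q^\alpha_{\mathbf X},[0,T]}=\|Y^{\dagger\dagger}\|_{\alpha\text{-hld}}+\|Y^\sharp\|_{3\alpha\text{-hld}}+\|Y^{\sharp\sharp}\|_{2\alpha\text{-hld}}$, and $d_{\mathbf X,\tilde{\mathbf X},3\alpha}(Y,Y^\dagger,Y^{\dagger\dagger};\tilde Y,\tilde Y^\dagger,\tilde Y^{\dagger\dagger})=\|Y^{\dagger\dagger}-\tilde Y^{\dagger\dagger}\|_{\alpha\text{-hld}}+\|Y^\sharp-\tilde Y^\sharp\|_{3\alpha\text{-hld}}+\|Y^{\sharp\sharp}-\tilde Y^{\sharp\sharp}\|_{2\alpha\text{-hld}}$.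 For $\mathcal E=L(\mathcal V,\mathcal W)$ the rough integral is $\int_s^tY\,d\mathbf X=\lim\sum_l(Y_{t_{l-1}}X^1_{t_{l-1},t_l}+Y^\dagger_{t_{l-1}}X^2_{t_{l-1},t_l}+Y^{\dagger\dagger}_{t_{l-1}}X^3_{t_{l-1},t_l})$ along partitions of $[s,t]$ with mesh tending to $0$; the limit exists since $4\alpha>1$. ($Y^\dagger$ and $Y^{\dagger\dagger}$ act on $\mathcal V^{\otimes 2}$, $\mathcal V^{\otimes 3}$ by feeding the tensor factors in from left to right.) *)

(* Defs.v *)
From HB Require Import structures.
From mathcomp Require Import all_boot all_order all_algebra.
From mathcomp Require Import all_classical all_reals all_analysis.

Set Implicit Arguments.
Unset Strict Implicit.
Unset Printing Implicit Defensive.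

Import Order.TTheory GRing.Theory Num.Theory.
Import numFieldNormedType.Exports.

Local Open Scope classical_set_scope.
Local Open Scope ring_scope.

(* The Euclidean space R^I on a finite index type I.  All spaces below are of *)
(* this form, in coordinates with respect to orthonormal bases:               *)
(*   V = R^I, V^{(x)2} = R^(I*I), V^{(x)3} = R^(I*I*I), L(V, R^J) = R^(I*J),  *)
(* where A : euc R (I * J) is the linear map e_i |-> (A (i, j))_j; so linear  *)
(* maps and tensors carry the Hilbert-Schmidt norm.  In particular            *)
(*   L(V, L(V, R^J)) = R^(I*(I*J)).                                           *)
Definition euc (R : realType) (I : finType) := {ffun I -> R}.

Section Spaces.
Context {R : realType}.
Implicit Types I J : finType.

Definition enorm I (v : euc R I) : R := Num.sqrt (\sum_i v i ^+ 2).

Definition tens11 I (x y : euc R I) : euc R (I * I)%type :=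
  [ffun p => x p.1 * y p.2].
Definition tens12 I (x : euc R I) (y : euc R (I * I)%type) :
    euc R (I * I * I)%type :=
  [ffun p => x p.1.1 * y (p.1.2, p.2)].
Definition tens21 I (x : euc R (I * I)%type) (y : euc R I) :
    euc R (I * I * I)%type :=
  [ffun p => x p.1 * y p.2].

Definition app I J (A : euc R (I * J)%type) (x : euc R I) : euc R J :=
  [ffun j => \sum_i A (i, j) * x i].

(* app2 and app3 are the linear extensions of a (x) b |-> (A a) b and         *)
(* a (x) b (x) c |-> ((A a) b) c.                                             *)
Definition app2 I J (A : euc R (I * (I * J))%type) (x : euc R (I * I)%type) :
    euc R J :=
  [ffun j => \sum_p A (p.1, (p.2, j)) * x p].
Definition app3 I J (A : euc R (I * (I * (I * J)))%type)
    (x : euc R (I * I * I)%type) : euc R J :=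
  [ffun j => \sum_p A (p.1.1, (p.1.2, (p.2, j))) * x p].

End Spaces.

(* Elements (a0, a1, a2, a3) of the truncated tensor algebra                  *)
(* R (+) V (+) V^{(x)2} (+) V^{(x)3}.                                         *)
Record ttens (R : realType) (I : finType) := TTens {
  tt0 : R;
  tt1 : euc R I;
  tt2 : euc R (I * I)%type;
  tt3 : euc R (I * I * I)%type }.

Definition ttmul (R : realType) (I : finType) (a b : ttens R I) : ttens R I :=
  TTens
    (tt0 a * tt0 b)
    (tt0 a *: tt1 b + tt0 b *: tt1 a)
    (tt0 a *: tt2 b + tens11 (tt1 a) (tt1 b) + tt0 b *: tt2 a)
    (tt0 a *: tt3 b + tens12 (tt1 a) (tt2 b) + tens21 (tt2 a) (tt1 b)
      + tt0 b *: tt3 a).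

(* Functions on [0, T] and on Delta_T are represented by total functions on R *)
(* and R * R (curried); their values elsewhere are never used.                *)

Section Holder.
Context {R : realType}.
Implicit Types (I : finType) (T eta : R).

Definition Delta T : set (R * R) := [set p | [/\ 0 <= p.1, p.1 <= p.2 & p.2 <= T]].

Definition continuous_Delta I T (psi : R -> R -> euc R I) :=
  forall p, Delta T p ->
    enorm (psi q.1 q.2 - psi p.1 p.2) @[q --> within (Delta T) (nbhs p)] --> 0.

Definition holder2 I T eta (psi : R -> R -> euc R I) : \bar R :=
  ereal_sup [set x | exists s t : R, [/\ 0 <= s, s < t, t <= T &
    x = (enorm (psi s t) / (t - s) `^ eta)%:E]].

Definition holder I T eta (phi : R -> euc R I) : \bar R :=
  holder2 T eta (fun s t => phi t - phi s).

End Holder.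

Record rough (R : realType) (I : finType) := Rough {
  lev1 : R -> R -> euc R I;
  lev2 : R -> R -> euc R (I * I)%type;
  lev3 : R -> R -> euc R (I * I * I)%type }.

(* (1, X_{s,t}) *)
Definition rough_tt (R : realType) (I : finType) (X : rough R I) (s t : R) :=
  TTens 1 (lev1 X s t) (lev2 X s t) (lev3 X s t).

Section RoughPaths.
Context {R : realType}.
Implicit Types (I J : finType) (alpha T : R).
Local Open Scope ereal_scope.

Definition rough_norm I alpha T (X : rough R I) : \bar R :=
  holder2 T alpha (lev1 X) + holder2 T (2 * alpha)%R (lev2 X)
  + holder2 T (3 * alpha)%R (lev3 X).

Definition rough_dist I alpha T (X X' : rough R I) : \bar R :=
  holder2 T alpha (fun s t => lev1 X s t - lev1 X' s t)%R
  + holder2 T (2 * alpha)%R (fun s t => lev2 X s t - lev2 X' s t)%R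
  + holder2 T (3 * alpha)%R (fun s t => lev3 X s t - lev3 X' s t)%R.

Definition is_rough_path I alpha T (X : rough R I) : Prop :=
  [/\ [/\ continuous_Delta T (lev1 X), continuous_Delta T (lev2 X)
        & continuous_Delta T (lev3 X)],
      forall s u t : R, (0 <= s)%R -> (s <= u)%R -> (u <= t)%R -> (t <= T)%R ->
        rough_tt X s t = ttmul (rough_tt X s u) (rough_tt X u t)
    & rough_norm alpha T X < +oo].

End RoughPaths.

(* Triples (Y, Y^dagger, Y^{dagger dagger}) of paths in E = R^J, L(V, E) and  *)
(* L(V, L(V, E)), where V = R^I.                                              *)
Record ctriple (R : realType) (I J : finType) := CTriple {
  cp0 : R -> euc R J;
  cp1 : R -> euc R (I * J)%type;
  cp2 : R -> euc R (I * (I * J))%type }.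

Section Controlled.
Context {R : realType}.
Implicit Types (I J : finType) (alpha T : R).

Definition sharp I J (X : rough R I) (Y : ctriple R I J) (s t : R) : euc R J :=
  cp0 Y t - cp0 Y s - app (cp1 Y s) (lev1 X s t) - app2 (cp2 Y s) (lev2 X s t).

Definition ssharp I J (X : rough R I) (Y : ctriple R I J) (s t : R) :
    euc R (I * J)%type :=
  cp1 Y t - cp1 Y s - app (cp2 Y s) (lev1 X s t).

Local Open Scope ereal_scope.

Definition controlled I J alpha T (X : rough R I) (Y : ctriple R I J) : Prop :=
  [/\ [/\ holder T alpha (cp0 Y) < +oo, holder T alpha (cp1 Y) < +oo
        & holder T alpha (cp2 Y) < +oo],
      holder2 T (3 * alpha)%R (sharp X Y) < +oo
    & holder2 T (2 * alpha)%R (ssharp X Y) < +oo].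

Definition ctrl_norm I J alpha T (X : rough R I) (Y : ctriple R I J) : \bar R :=
  holder T alpha (cp2 Y) + holder2 T (3 * alpha)%R (sharp X Y)
  + holder2 T (2 * alpha)%R (ssharp X Y).

Definition ctrl_dist I J alpha T (X X' : rough R I) (Y Y' : ctriple R I J) :
    \bar R :=
  holder T alpha (fun t => cp2 Y t - cp2 Y' t)%R
  + holder2 T (3 * alpha)%R (fun s t => sharp X Y s t - sharp X' Y' s t)%R
  + holder2 T (2 * alpha)%R (fun s t => ssharp X Y s t - ssharp X' Y' s t)%R.

End Controlled.

Section Integral.
Context {R : realType} {I J : finType}.
(* Y takes its values in L(V, W), where V = R^I and W = R^J. *)
Variables (X : rough R I) (Y : ctriple R I (I * J)%type).

Definition germ (s t : R) : euc R J :=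
  app (cp0 Y s) (lev1 X s t) + app2 (cp1 Y s) (lev2 X s t)
  + app3 (cp2 Y s) (lev3 X s t).

(* itv_partition s t p: the points of the partition are s :: p, from s to t. *)
Definition germ_sum (s t : R) (p : seq R) : euc R J :=
  \sum_(0 <= l < size p) germ (nth t (s :: p) l) (nth t p l).

Definition mesh_lt (s t delta : R) (p : seq R) : Prop :=
  forall l, (l < size p)%N -> nth t p l - nth t (s :: p) l < delta.

Definition is_rough_integral (s t : R) (z : euc R J) : Prop :=
  forall eps : R, 0 < eps -> exists2 delta : R, 0 < delta &
    forall p : seq R, itv_partition s t p -> mesh_lt s t delta p ->
      enorm (germ_sum s t p - z) < eps.

(* The value is 0 if the limit does not exist. *)
Definition rough_integral (s t : R) : euc R J :=
  xget 0 [set z | is_rough_integral s t z].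

Definition integral_triple : ctriple R I J :=
  CTriple (fun t => rough_integral 0 t) (cp0 Y) (cp1 Y).

End Integral.

(* The right-hand side of the continuity estimates, up to the constant. *)
Definition data_dist (R : realType) (I J : finType) (alpha T : R)
    (X X' : rough R I) (Y Y' : ctriple R I J) : \bar R :=
  (rough_dist alpha T X X'
   + (enorm (cp0 Y 0%R - cp0 Y' 0%R))%:E
   + (enorm (cp1 Y 0%R - cp1 Y' 0%R))%:E
   + (enorm (cp2 Y 0%R - cp2 Y' 0%R))%:E
   + (T `^ alpha)%:E * ctrl_dist alpha T X X' Y Y')%E.

(* X and Y are admissible data, bounded by M. *)
Definition bounded_data (R : realType) (I J : finType) (alpha T M : R)
    (X : rough R I) (Y : ctriple R I J) : Prop :=
  [/\ is_rough_path alpha T X,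
      controlled alpha T X Y,
      ((enorm (cp0 Y 0))%:E + (enorm (cp1 Y 0))%:E + (enorm (cp2 Y 0))%:E
         + ctrl_norm alpha T X Y <= M%:E)%E
    & (rough_norm alpha T X <= M%:E)%E].

(* Main.v *)
(** By Chen's relation, the defect of the germ
    [Xi_{s,t} = Y_s X1_{s,t} + Y'_s X2_{s,t} + Y''_s X3_{s,t}] is
    [Xi_{s,t} - Xi_{s,u} - Xi_{u,t} = - (Y#_{s,u} X1_{u,t} + Y##_{s,u} X2_{u,t}
     + (Y''_u - Y''_s) X3_{u,t})], which is O((t - s)^(4 alpha)) with
    4 alpha > 1.  The sewing lemma then gives the integral, with remainder
    [int_s^t Y dX - Xi_{s,t}] of order 4 alpha.  The difference of the germs of
    (X, Y) and (X~, Y~) has a defect bounded by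
    (d(Y, Y~) + rho(X, X~)) (t - s)^(4 alpha), so the difference of the
    remainders satisfies the same bound; only order 3 alpha is needed, and the
    spare factor (t - s)^alpha <= T^alpha sits in front of d(Y, Y~).  All other
    terms of Z# and Z## contain X or Y#, for which the same exchange works. *)

Require Import Defs.
From HB Require Import structures.
From mathcomp Require Import all_boot all_order all_algebra.
From mathcomp Require Import all_classical all_reals all_analysis.
From mathcomp Require Import ring lra.

Set Implicit Arguments.
Unset Strict Implicit.
Unset Printing Implicit Defensive.

Import Order.TTheory GRing.Theory Num.Theory.
Import numFieldNormedType.Exports.

Local Open Scope classical_set_scope.
Local Open Scope ring_scope.

(** * Euclidean and Hilbert-Schmidt norms *)

Section FiniteSums.
Context {R : realType}.

(** Lagrange's identity: twice the difference of the two sides is the double sum of the squares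
    [(a i * b j - a j * b i) ^+ 2]. *)
Lemma cauchy_schwarz_sum (I : finType) (a b : I -> R) :
  (\sum_i a i * b i) ^+ 2 <= (\sum_i a i ^+ 2) * (\sum_i b i ^+ 2).
Proof.
rewrite -subr_ge0 -(pmulr_rge0 _ (ltr0n R 2)).
have -> : 2 * ((\sum_i a i ^+ 2) * (\sum_i b i ^+ 2) - (\sum_i a i * b i) ^+ 2)
   = \sum_i \sum_j (a i * b j - a j * b i) ^+ 2.
  have prodE (f g : I -> R) :
      (\sum_i f i) * (\sum_j g j) = \sum_i \sum_j f i * g j.
    by rewrite big_distrl; apply: eq_bigr => i _; rewrite big_distrr.
  set A := \sum_i a i ^+ 2; set B := \sum_i b i ^+ 2; set S := \sum_i _ * _.
  have -> : 2 * (A * B - S ^+ 2) = A * B + B * A - 2 * (S * S) by ring.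
  rewrite !prodE !mulr_sumr -big_split -sumrB; apply: eq_bigr => i _ /=.
  rewrite !mulr_sumr -big_split -sumrB; apply: eq_bigr => j _ /=.
  by ring.
by do 2![apply: sumr_ge0 => ? _]; exact: sqr_ge0.
Qed.

(** Cauchy-Schwarz for each [j]. With suitable index types [P] this bounds [app], [app2] and [app3]
    alike by the Hilbert-Schmidt norm. *)
Lemma contraction_le (P J : finType) (B : P -> J -> R) (x : P -> R) :
  \sum_j (\sum_p B p j * x p) ^+ 2
    <= (\sum_p \sum_j B p j ^+ 2) * (\sum_p x p ^+ 2).
Proof.
rewrite exchange_big big_distrl; apply: ler_sum => j _.
exact: cauchy_schwarz_sum.
Qed.

End FiniteSums.

Section EuclideanNorm.
Context {R : realType}.
Implicit Types I J : finType.

Lemma enorm_ge0 I (v : euc R I) : 0 <= enorm v.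
Proof. exact: sqrtr_ge0. Qed.

Lemma enorm_sqr I (v : euc R I) : enorm v ^+ 2 = \sum_i v i ^+ 2.
Proof. by rewrite sqr_sqrtr // sumr_ge0 // => i _; rewrite sqr_ge0. Qed.

Lemma enorm_le I (v : euc R I) (c : R) :
  0 <= c -> \sum_i v i ^+ 2 <= c ^+ 2 -> enorm v <= c.
Proof. by move=> c0; rewrite -enorm_sqr ler_sqr ?nnegrE // enorm_ge0. Qed.

Lemma enorm0 I : enorm (0 : euc R I) = 0.
Proof.
by rewrite /enorm big1 ?sqrtr0 // => i _; rewrite ffunE expr0n.
Qed.

Lemma enormN I (v : euc R I) : enorm (- v) = enorm v.
Proof. by rewrite /enorm; under eq_bigr do rewrite ffunE sqrrN. Qed.

Lemma enormD_le I (v w : euc R I) : enorm (v + w) <= enorm v + enorm w.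
Proof.
apply: enorm_le; first by rewrite addr_ge0 ?enorm_ge0.
have -> : \sum_i (v + w) i ^+ 2
    = enorm v ^+ 2 + 2 * (\sum_i v i * w i) + enorm w ^+ 2.
  rewrite !enorm_sqr mulr_sumr -!big_split /=.
  by apply: eq_bigr => i _; rewrite ffunE; ring.
suff : \sum_i v i * w i <= enorm v * enorm w by rewrite sqrrD; lra.
apply: le_trans (ler_norm _) _.
rewrite -ler_sqr ?nnegrE ?normr_ge0 ?mulr_ge0 ?enorm_ge0 //.
by rewrite real_normK ?num_real // exprMn !enorm_sqr cauchy_schwarz_sum.
Qed.

Lemma enormD_trans I (v w : euc R I) (a b : R) :
  enorm v <= a -> enorm w <= b -> enorm (v + w) <= a + b.
Proof. by move=> va wb; apply: le_trans (enormD_le _ _) (lerD va wb). Qed.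

Lemma enormB_trans I (v w : euc R I) (a b : R) :
  enorm v <= a -> enorm w <= b -> enorm (v - w) <= a + b.
Proof. by rewrite -(enormN w); exact: enormD_trans. Qed.

Lemma enorm_coord I (v : euc R I) i : `|v i| <= enorm v.
Proof.
rewrite -ler_sqr ?nnegrE ?normr_ge0 ?enorm_ge0 // real_normK ?num_real //.
rewrite enorm_sqr (bigD1 i) //= lerDl sumr_ge0 // => j _; exact: sqr_ge0.
Qed.

Lemma enorm_le_sum I (v : euc R I) : enorm v <= \sum_i `|v i|.
Proof.
have sum0 (P : pred I) : 0 <= \sum_(i | P i) `|v i|.
  by apply: sumr_ge0 => i _; exact: normr_ge0.
apply: enorm_le => //; rewrite expr2 big_distrl; apply: ler_sum => i _ /=.
rewrite -(real_normK (num_real (v i))) expr2 ler_wpM2l ?normr_ge0 //.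
by rewrite (bigD1 i) //= lerDl.
Qed.

Lemma enorm_app_le I J (A : euc R (I * J)%type) (x : euc R I) :
  enorm (app A x) <= enorm A * enorm x.
Proof.
apply: enorm_le; first by rewrite mulr_ge0 ?enorm_ge0.
under eq_bigr do rewrite ffunE.
apply: le_trans (contraction_le (fun i j => A (i, j)) x) _.
rewrite exprMn !enorm_sqr pair_bigA /=.
by under eq_bigr do rewrite -surjective_pairing.
Qed.

Lemma enorm_app2_le I J (A : euc R (I * (I * J))%type) (x : euc R (I * I)%type) :
  enorm (app2 A x) <= enorm A * enorm x.
Proof.
apply: enorm_le; first by rewrite mulr_ge0 ?enorm_ge0.
under eq_bigr do rewrite ffunE.
apply: le_trans (contraction_le (fun p j => A (p.1, (p.2, j))) x) _.
rewrite exprMn !enorm_sqr pair_bigA /=.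
(* The contraction sums over ((i, k), j), while the coefficients of [A] are indexed by (i, (k,
   j)). *)
rewrite (reindex (fun u : I * (I * J) => ((u.1, u.2.1), u.2.2))) /=.
  by under eq_bigr do rewrite -!surjective_pairing.
by exists (fun u => (u.1.1, (u.1.2, u.2))) => [[? []] | [[]]].
Qed.

Lemma enorm_app3_le I J (A : euc R (I * (I * (I * J)))%type)
    (x : euc R (I * I * I)%type) :
  enorm (app3 A x) <= enorm A * enorm x.
Proof.
apply: enorm_le; first by rewrite mulr_ge0 ?enorm_ge0.
under eq_bigr do rewrite ffunE.
apply: le_trans
  (contraction_le (fun p j => A (p.1.1, (p.1.2, (p.2, j)))) x) _.
rewrite exprMn !enorm_sqr pair_bigA /=.
rewrite (reindex (fun u : I * (I * (I * J)) =>
  ((u.1, u.2.1, u.2.2.1), u.2.2.2))) /=.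
  by under eq_bigr do rewrite -!surjective_pairing.
by exists (fun u => (u.1.1.1, (u.1.1.2, (u.1.2, u.2))))
  => [[? [? []]] | [[[]]]].
Qed.

Lemma appD I J (A : euc R (I * J)%type) (x y : euc R I) :
  app A (x + y) = app A x + app A y.
Proof.
apply/ffunP => j; rewrite !ffunE -big_split; apply: eq_bigr => i _.
by rewrite ffunE mulrDr.
Qed.

Lemma app2D I J (A : euc R (I * (I * J))%type) (x y : euc R (I * I)%type) :
  app2 A (x + y) = app2 A x + app2 A y.
Proof.
apply/ffunP => j; rewrite !ffunE -big_split; apply: eq_bigr => i _.
by rewrite ffunE mulrDr.
Qed.

Lemma app3D I J (A : euc R (I * (I * (I * J)))%type)
    (x y : euc R (I * I * I)%type) :
  app3 A (x + y) = app3 A x + app3 A y.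
Proof.
apply/ffunP => j; rewrite !ffunE -big_split; apply: eq_bigr => i _.
by rewrite ffunE mulrDr.
Qed.

Lemma appBr I J (A : euc R (I * J)%type) (x y : euc R I) :
  app A (x - y) = app A x - app A y.
Proof.
apply/ffunP => j; rewrite !ffunE -sumrB; apply: eq_bigr => i _.
by rewrite !ffunE mulrBr.
Qed.

Lemma app2Br I J (A : euc R (I * (I * J))%type) (x y : euc R (I * I)%type) :
  app2 A (x - y) = app2 A x - app2 A y.
Proof.
apply/ffunP => j; rewrite !ffunE -sumrB; apply: eq_bigr => i _.
by rewrite !ffunE mulrBr.
Qed.

Lemma app3Br I J (A : euc R (I * (I * (I * J)))%type)
    (x y : euc R (I * I * I)%type) :
  app3 A (x - y) = app3 A x - app3 A y.
Proof.
apply/ffunP => j; rewrite !ffunE -sumrB; apply: eq_bigr => i _.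
by rewrite !ffunE mulrBr.
Qed.

Lemma appBl I J (A B : euc R (I * J)%type) (x : euc R I) :
  app (A - B) x = app A x - app B x.
Proof.
apply/ffunP => j; rewrite !ffunE -sumrB; apply: eq_bigr => i _.
by rewrite !ffunE mulrBl.
Qed.

Lemma app2Bl I J (A B : euc R (I * (I * J))%type) (x : euc R (I * I)%type) :
  app2 (A - B) x = app2 A x - app2 B x.
Proof.
apply/ffunP => j; rewrite !ffunE -sumrB; apply: eq_bigr => i _.
by rewrite !ffunE mulrBl.
Qed.

Lemma app3Bl I J (A B : euc R (I * (I * (I * J)))%type)
    (x : euc R (I * I * I)%type) :
  app3 (A - B) x = app3 A x - app3 B x.
Proof.
apply/ffunP => j; rewrite !ffunE -sumrB; apply: eq_bigr => i _.
by rewrite !ffunE mulrBl.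
Qed.

(** This and the next two identities turn iterated application into application to a tensor product,
    so that the expansions of the controlled path cancel the cross terms of Chen's relation in
    [germ_defectE]. *)
Lemma app_app I J (A : euc R (I * (I * J))%type) (x y : euc R I) :
  app (app A x) y = app2 A (tens11 x y).
Proof.
apply/ffunP => j; rewrite !ffunE.
transitivity (\sum_i \sum_k A (k, (i, j)) * (x k * y i)).
  apply: eq_bigr => i _; rewrite ffunE big_distrl /=.
  by apply: eq_bigr => k _; rewrite mulrA.
rewrite exchange_big pair_bigA /=.
by apply: eq_bigr => p _; rewrite ffunE.
Qed.

Lemma app_app2 I J (A : euc R (I * (I * (I * J)))%type)
    (x : euc R (I * I)%type) (y : euc R I) :
  app (app2 A x) y = app3 A (tens21 x y).
Proof.
apply/ffunP => j; rewrite !ffunE.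
transitivity (\sum_i \sum_p A (p.1, (p.2, (i, j))) * (x p * y i)).
  apply: eq_bigr => i _; rewrite ffunE big_distrl /=.
  by apply: eq_bigr => k _; rewrite mulrA.
rewrite exchange_big pair_bigA /=.
by apply: eq_bigr => p _; rewrite ffunE.
Qed.

Lemma app2_app I J (A : euc R (I * (I * (I * J)))%type)
    (x : euc R I) (y : euc R (I * I)%type) :
  app2 (app A x) y = app3 A (tens12 x y).
Proof.
apply/ffunP => j; rewrite !ffunE.
transitivity (\sum_p \sum_i A (i, (p.1, (p.2, j))) * (x i * y p)).
  apply: eq_bigr => p _; rewrite ffunE big_distrl /=.
  by apply: eq_bigr => k _; rewrite mulrA.
rewrite exchange_big pair_bigA /=.
rewrite (reindex (fun u : I * I * I => (u.1.1, (u.1.2, u.2)))) /=.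
  by apply: eq_bigr => p _; rewrite ffunE.
by exists (fun u => ((u.1, u.2.1), u.2.2)) => [[[]] | [? []]].
Qed.

End EuclideanNorm.

(** * The sewing lemma *)

Section PartitionSums.
Context {R : realType} {J : finType}.
Implicit Types (g : R -> R -> euc R J) (s t d : R) (p q r : seq R).

(* The points of the partition are s :: p. *)
Fixpoint rsum g s p : euc R J :=
  if p is x :: p' then g s x + rsum g x p' else 0.

Definition gaps_lt d s p := path (fun x y => y - x < d) s p.

(** The limit of [is_rough_integral] for an arbitrary germ, phrased with recursive sums and [path]
    to allow induction along the partition. *)
Definition sewn g s t (z : euc R J) : Prop :=
  forall eps : R, 0 < eps -> exists2 d : R, 0 < d &
    forall p, itv_partition s t p -> gaps_lt d s p ->
      enorm (rsum g s p - z) < eps.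

Lemma rsum_cat g s p q : rsum g s (p ++ q) = rsum g s p + rsum g (last s p) q.
Proof. by elim: p s => [|x p IH] s /=; rewrite ?add0r // IH addrA. Qed.

Lemma rsumB g g' s p :
  rsum (fun a b => g a b - g' a b) s p = rsum g s p - rsum g' s p.
Proof.
elim: p s => [|x p IH] s /=; first by rewrite subr0.
by rewrite IH opprD addrACA.
Qed.

Lemma path_lt_le_last s p : path <%O s p -> s <= last s p.
Proof.
elim: p s => //= a p IH s /andP[sa ap].
exact: le_trans (ltW sa) (IH _ ap).
Qed.

Lemma path_lt_mem s p x : path <%O s p -> x \in p -> s < x <= last s p.
Proof.
elim: p s => // a p IH s /= /andP[sa ap]; rewrite inE => /orP[/eqP ->|xp].
  by rewrite sa path_lt_le_last.
by have /andP[ax ->] := IH _ ap xp; rewrite (lt_trans sa ax).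
Qed.

Lemma gaps_lt_le d d' s p : d <= d' -> gaps_lt d s p -> gaps_lt d' s p.
Proof. by move=> dd'; apply: sub_path => x y /lt_le_trans; apply. Qed.

Lemma gaps_lt_min d d' s p :
  gaps_lt (Num.min d d') s p -> gaps_lt d s p /\ gaps_lt d' s p.
Proof.
by move=> gp; split; apply: gaps_lt_le gp; rewrite ge_min lexx ?orbT.
Qed.

(** Steps of length d / 2, until the rest is shorter than d; the induction is on a bound for the
    number of such steps. *)
Lemma fine_partition_exists d s t : 0 < d -> s <= t ->
  exists2 p, itv_partition s t p & gaps_lt d s p.
Proof.
move=> d0 st; have [n] : exists n : nat, t - s <= n%:R * (d / 2).
  exists (Num.truncn ((t - s) / (d / 2))).+1.
  by rewrite -ler_pdivrMr ?divr_gt0 // ltW // truncnS_gt.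
elim: n s st => [|n IH] s st; rewrite -?[n.+1]addn1 ?natrD => tsn.
  have -> : s = t by lra.
  by exists [::].
have [ts|ts] := ltP (t - s) d.
  move: st; rewrite le_eqVlt => /orP[/eqP -> | st]; first by exists [::].
  by exists [:: t]; [exact: itv_partition1 | rewrite /gaps_lt /= ts].
have [||p [pp lp] gp] := IH (s + d / 2); [lra|lra|].
exists (s + d / 2 :: p); first by split => //=; rewrite pp andbT; lra.
by rewrite /gaps_lt /= -/(gaps_lt d _ p) gp andbT; lra.
Qed.

Lemma path_lt_split s p m : path <%O s p -> s <= m < last s p ->
  exists p1 b p2, p = p1 ++ b :: p2 /\ last s p1 <= m < b.
Proof.
elim: p s => [|a p IH] s /=; first by move=> _; lra.
move=> /andP[sa ap] /andP[sm ml]; have [am|ma] := leP a m.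
  have [|p1 [b [p2 [-> h]]]] := IH _ ap; first by rewrite am ml.
  by exists (a :: p1), b, p2.
by exists [::], a, p; rewrite /= sm ma.
Qed.

(** The refinement is the sorted union of the two lists of points, without repetitions. *)
Lemma common_refinement s t p q : itv_partition s t p -> itv_partition s t q ->
  exists r, [/\ itv_partition s t r, {subset p <= r} & {subset q <= r}].
Proof.
move=> [sp /eqP lp] [sq /eqP lq].
pose r := sort <=%O (undup (p ++ q)).
have memr x : (x \in r) = (x \in p) || (x \in q).
  by rewrite mem_sort mem_undup mem_cat.
have inr x : x \in r -> s < x <= t.
  rewrite memr => /orP[] h; first by rewrite -lp; exact: path_lt_mem.
  by rewrite -lq; exact: path_lt_mem.
have sr : path <%O s r.
  rewrite path_min_sorted ?sort_lt_sorted ?undup_uniq //.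
  by apply/allP => x /inr /andP[].
exists r; split=> [|x xp|x xq]; rewrite ?memr ?xp ?xq ?orbT //.
(* If s < t, then t is a point of [p], hence the last point of [r]; otherwise no point lies in ]s,
   t] and [r] is empty. *)
split=> //; have [st|ts] := ltP s t.
  have tr : t \in r.
    rewrite memr; case: (p) lp st => [/= ->|x p' <- _]; first by rewrite ltxx.
    by rewrite /= mem_last.
  have /andP[_ tl] := path_lt_mem sr tr.
  rewrite eq_le tl andbT; have := mem_last s r; rewrite inE => /orP[/eqP ->|].
    exact: ltW.
  by move=> /inr /andP[].
have -> : r = [::].
  case: r inr {memr sr} => // x r' /(_ _ (mem_head x r')) /andP[sx xt].
  by have := lt_le_trans sx xt; rewrite ltNge ts.
by apply/eqP/le_anti; rewrite ts -lp path_lt_le_last.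
Qed.

(** Linearity allows the sewing bound to be applied to a difference of two germs, whose defect is
    small when the data are close. *)
Lemma sewnB g g' s t z z' : sewn g s t z -> sewn g' s t z' ->
  sewn (fun a b => g a b - g' a b) s t (z - z').
Proof.
move=> gz gz' eps eps0.
have [d1 d10 h1] := gz (eps / 2) (divr_gt0 eps0 (ltr0n _ 2)).
have [d2 d20 h2] := gz' (eps / 2) (divr_gt0 eps0 (ltr0n _ 2)).
exists (Num.min d1 d2) => [|p pst gp]; first by rewrite lt_min d10.
have [/(h1 p pst) {}h1 /(h2 p pst) {}h2] := gaps_lt_min gp.
rewrite rsumB opprD addrACA -opprD.
by apply: le_lt_trans (enormD_le _ _) _; rewrite enormN; lra.
Qed.

End PartitionSums.

(** * Existence of the sewn limit and its local remainder *)

Section Sewing.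
Context {R : realType} {J : finType}.
Variables (g : R -> R -> euc R J) (T N theta : R).
Hypothesis theta_gt1 : 1 < theta.
Hypothesis N_ge0 : 0 <= N.
Hypothesis defect_le : forall s u t : R, 0 <= s -> s <= u -> u <= t -> t <= T ->
  enorm (g s t - g s u - g u t) <= N * (t - s) `^ theta.
Implicit Types (s t d : R) (p q r : seq R).

Let theta_gt0 : 0 < theta. Proof. exact: lt_trans theta_gt1. Qed.
Let theta1_gt0 : 0 < theta - 1. Proof. by rewrite subr_gt0. Qed.

(** Here theta > 1 enters: two halves of an interval together carry the factor 2 * (1/2)^theta < 1,
    so the recursion over midpoints has a finite constant. *)
Lemma half_powR_lt : 2^-1 `^ theta < 2^-1 :> R.
Proof.
rewrite -mulr_powRB1 ?invr_ge0 //.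
have : 2^-1 `^ (theta - 1) < 1 `^ (theta - 1) :> R.
  by apply: gt0_ltr_powR; rewrite ?nnegrE ?theta1_gt0 //; lra.
by rewrite powR1; lra.
Qed.

(* Chosen so that 2 * (1/2)^theta * sew_const + 2 = sew_const. *)
Definition sew_const : R := 2 / (1 - 2 * 2^-1 `^ theta).

Lemma sew_const_gt0 : 0 < sew_const.
Proof. by have h := half_powR_lt; apply: divr_gt0; lra. Qed.

Lemma sew_constE : sew_const * (2 * 2^-1 `^ theta) + 2 = sew_const.
Proof.
have h := half_powR_lt; rewrite /sew_const; field.
by apply/eqP; lra.
Qed.

(** At s = u = t the defect is [- g s s], and its bound is N * 0^theta = 0. *)
Lemma germ_diag0 s : 0 <= s <= T -> g s s = 0.
Proof.
move=> /andP[s0 sT]; have := defect_le s0 (lexx s) (lexx s) sT.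
rewrite (subrr s) powR0 ?gt_eqF //.
rewrite mulr0 subrr sub0r enormN => gs; apply/ffunP => j; rewrite ffunE.
apply/eqP; rewrite -normr_le0; exact: le_trans (enorm_coord _ _) gs.
Qed.

(* Drop the interval [a, b] containing the midpoint of [s, last s p]: the two *)
(* remaining pieces have at most half the length.                             *)
Lemma rsum_germ_le s p : 0 <= s -> path <%O s p -> last s p <= T ->
  enorm (rsum g s p - g s (last s p))
    <= sew_const * N * (last s p - s) `^ theta.
Proof.
have cN0 : 0 <= sew_const * N by rewrite mulr_ge0 // ltW ?sew_const_gt0.
(* Strong induction on the number of points: dropping an interval leaves two strictly shorter
   partitions. *)
have [n] := ubnP (size p); elim: n p s => // n IH p s pn s0 sp lT.
have := path_lt_le_last sp; move tE : (last s p) lT => t lT.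
rewrite le_eqVlt => /orP[/eqP st|st].
  have -> : p = [::].
    case: p sp tE {lT pn IH} => // x p sp tE.
    have := path_lt_mem sp (mem_head x p).
    by rewrite tE st => /andP[/lt_le_trans h /h]; rewrite ltxx.
  rewrite -st in lT *; rewrite /= sub0r enormN germ_diag0 ?s0 // enorm0.
  by rewrite (mulr_ge0 cN0) ?powR_ge0.
have [|p1 [b [p2 [pE /andP[am mb]]]]] :=
  @path_lt_split _ s p ((s + t) / 2) sp; first by rewrite tE; lra.
move aE : (last s p1) am => a am.
move: sp pn tE; rewrite pE cat_path size_cat last_cat /= aE addnS ltnS.
move=> /and3P[sp1 ab bp2] pn tE.
have sa : s <= a by rewrite -aE path_lt_le_last.
have bt : b <= t by rewrite -tE path_lt_le_last.
have h1 : enorm (rsum g s p1 - g s a) <= sew_const * N * (a - s) `^ theta.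
  rewrite -aE; apply: IH => //; last by rewrite aE; lra.
  by apply: leq_ltn_trans pn; rewrite leq_addr.
have h2 : enorm (rsum g b p2 - g b t) <= sew_const * N * (t - b) `^ theta.
  rewrite -tE; apply: IH => //; rewrite ?tE //; last by lra.
  by apply: leq_ltn_trans pn; rewrite leq_addl.
(* Splitting [s, t] at [b] and then [s, b] at [a] costs two defects and produces the term [g a b] of
   the dropped interval. *)
have h3 : enorm (g s t - g s b - g b t) <= N * (t - s) `^ theta.
  by apply: defect_le => //; lra.
have h4 : enorm (g s b - g s a - g a b) <= N * (b - s) `^ theta.
  by apply: defect_le => //; lra.
have mono x y : 0 <= x -> x <= y -> x `^ theta <= y `^ theta.
  by move=> x0 xy; apply: ge0_ler_powR; rewrite ?nnegrE ?(ltW theta_gt0) ?(ltW theta1_gt0) //; lra.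
have halfE : ((t - s) * 2^-1) `^ theta = (t - s) `^ theta * 2^-1 `^ theta.
  by apply: powRM; lra.
rewrite rsum_cat /= aE.
have -> : rsum g s p1 + (g a b + rsum g b p2) - g s t =
   ((rsum g s p1 - g s a) + (rsum g b p2 - g b t))
     - ((g s t - g s b - g b t) + (g s b - g s a - g a b)).
  by apply/ffunP => j; rewrite !ffunE; ring.
apply: le_trans (enormB_trans (enormD_trans h1 h2) (enormD_trans h3 h4)) _.
have i1 : (a - s) `^ theta <= (t - s) `^ theta * 2^-1 `^ theta.
  by rewrite -halfE; apply: mono; lra.
have i2 : (t - b) `^ theta <= (t - s) `^ theta * 2^-1 `^ theta.
  by rewrite -halfE; apply: mono; lra.
have i3 : (b - s) `^ theta <= (t - s) `^ theta by apply: mono; lra.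
apply: le_trans (lerD (lerD (ler_wpM2l cN0 i1) (ler_wpM2l cN0 i2))
  (lerD (lexx _) (ler_wpM2l N_ge0 i3))) _.
(* The two halves contribute sew_const * 2 * (1/2)^theta and the two defects contribute 2;
   [sew_constE] adds them up. *)
rewrite -{3}sew_constE le_eqVlt; apply/orP; left; apply/eqP; ring.
Qed.

(** Each interval of [p] is refined by a piece of [r], to which [rsum_germ_le] applies. An interval
    of length h < d costs at most a multiple of h^theta <= d^(theta - 1) * h, and the lengths add
    up. *)
Lemma rsum_refine_le s p r d : 0 <= s -> path <%O s p -> path <%O s r ->
  {subset p <= r} -> last s p = last s r -> last s p <= T -> gaps_lt d s p ->
  enorm (rsum g s r - rsum g s p)
    <= sew_const * N * d `^ (theta - 1) * (last s p - s).
Proof.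
have cN0 : 0 <= sew_const * N by rewrite mulr_ge0 // ltW ?sew_const_gt0.
elim: p s r => [|a p IH] s r s0 /=.
  move=> _ sr _ lr _ _; have -> : r = [::].
    case: r sr lr => // x r sr lr.
    have /andP[sx] := path_lt_mem sr (mem_head x r).
    by rewrite -[last _ _]lr leNgt sx.
  by rewrite /= subrr enorm0 subrr mulr0.
move=> /andP[sa ap] sr pr lr lT /andP[asd gp].
have ar : a \in r by apply: pr; rewrite mem_head.
case/path.splitP: ar sr pr lr => r1 r2.
rewrite cat_path last_cat last_rcons => /andP[sr1 ar2] pr lr.
have aT : a <= T by apply: le_trans lT; exact: path_lt_le_last.
have h1 : enorm (rsum g s (rcons r1 a) - g s a)
    <= sew_const * N * (a - s) `^ theta.
  have := rsum_germ_le s0 sr1; rewrite last_rcons; exact.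
have h2 : enorm (rsum g a r2 - rsum g a p)
    <= sew_const * N * d `^ (theta - 1) * (last a p - a).
  apply: IH => //; first by lra.
  (* The later points of [p] exceed [a], so they cannot lie in the part of [r] up to [a]. *)
  move=> x xp; have := pr x; rewrite inE xp orbT mem_cat => /(_ isT) /orP[xr1|//].
  have /andP[ax _] := path_lt_mem ap xp.
  by have := path_lt_mem sr1 xr1; rewrite last_rcons; lra.
have i1 : (a - s) `^ theta <= d `^ (theta - 1) * (a - s).
  rewrite -mulr_powRB1 ?subr_ge0 ?(ltW sa) // mulrC ler_wpM2r ?subr_ge0 ?(ltW sa) //.
  by apply: ge0_ler_powR; rewrite ?nnegrE ?(ltW theta_gt0) ?(ltW theta1_gt0) //; lra.
rewrite rsum_cat last_rcons opprD addrACA.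
apply: le_trans (enormD_trans (le_trans h1 (ler_wpM2l cN0 i1)) h2) _.
rewrite le_eqVlt; apply/orP; left; apply/eqP; ring.
Qed.

(** Both sums are compared with the sum over a common refinement. *)
Lemma rsum_cauchy s t (eps : R) : 0 <= s -> t <= T -> 0 < eps ->
  exists2 d : R, 0 < d & forall p q,
    itv_partition s t p -> gaps_lt d s p ->
    itv_partition s t q -> gaps_lt d s q ->
    enorm (rsum g s p - rsum g s q) < eps.
Proof.
move=> s0 tT eps0.
(* The summand 1 makes [K] positive. The mesh bound chosen below satisfies d^(theta - 1) = e, where
   e * K = eps / 2. *)
pose K := sew_const * N * `|t - s| + 1.
have cN0 : 0 <= sew_const * N by rewrite mulr_ge0 // ltW ?sew_const_gt0.
have K0 : 0 < K by rewrite ltr_wpDl // mulr_ge0.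
pose e := eps / (2 * K).
have e0 : 0 < e by rewrite divr_gt0 // mulr_gt0.
exists (e `^ (theta - 1)^-1) => [|p q [sp /eqP lp] gp [sq /eqP lq] gq].
  exact: powR_gt0.
have [r [[sr /eqP lr] pr qr]] := common_refinement
  (conj sp (introT eqP lp)) (conj sq (introT eqP lq)).
have st : s <= t by rewrite -lp; exact: path_lt_le_last.
have main p' : path <%O s p' -> last s p' = t -> {subset p' <= r} ->
    gaps_lt (e `^ (theta - 1)^-1) s p' ->
    enorm (rsum g s r - rsum g s p') < eps / 2.
  move=> sp' lp' pr' gp'.
  have := @rsum_refine_le s p' r _ s0 sp' sr pr' _ _ gp'.
  rewrite lp' lr => /(_ erefl tT) /le_lt_trans; apply.
  rewrite -powRrM mulVf ?gt_eqF //.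
  rewrite powRr1; last exact: ltW.
  have -> : eps / 2 = e * K by rewrite /e; field; apply/eqP; lra.
  rewrite mulrAC [ltRHS]mulrC ltr_pM2r // /K ger0_norm; lra.
have -> : rsum g s p - rsum g s q =
    (rsum g s r - rsum g s q) - (rsum g s r - rsum g s p).
  by apply/ffunP => j; rewrite !ffunE; ring.
apply: le_lt_trans (enormB_trans (lexx _) (lexx _)) _.
by have := main p sp lp pr gp; have := main q sq lq qr gq; lra.
Qed.

(** The limit is built coordinatewise as a lower limit along partitions of vanishing mesh; the
    Cauchy property makes it a limit. *)
Lemma sewn_exists s t : 0 <= s -> s <= t -> t <= T -> exists z, sewn g s t z.
Proof.
move=> s0 st tT.
(* [A j] collects the eventual lower bounds of the j-th coordinate of the Riemann sums. *)
pose A j : set R := [set x | exists2 d : R, 0 < d & forall p,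
  itv_partition s t p -> gaps_lt d s p -> x <= rsum g s p j].
exists [ffun j => sup (A j)] => eps eps0.
(* Each coordinate will be within 2 * e of its limit; the added 1 makes the final bound strict and
   covers an empty [J]. *)
pose e := eps / (2 * #|J|%:R + 1).
have k0 : 0 < 2 * #|J|%:R + 1 :> R by rewrite ltr_wpDl // mulr_ge0.
have e0 : 0 < e by rewrite divr_gt0.
have [d d0 hd] := rsum_cauchy s0 tT e0; exists d => // p pst gp.
have coord j : `|(rsum g s p - [ffun j => sup (A j)]) j| <= 2 * e.
  have close q : itv_partition s t q -> gaps_lt d s q ->
      `|rsum g s q j - rsum g s p j| < e.
    move=> qst gq; apply: le_lt_trans (hd q p qst gq pst gp).
    by have := enorm_coord (rsum g s q - rsum g s p) j; rewrite !ffunE.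
  have Alow : A j (rsum g s p j - e).
    exists d => // q qst gq; have := close q qst gq; rewrite ltr_norml; lra.
  have Aup : ubound (A j) (rsum g s p j + e).
    move=> x [d' d'0 hx].
    (* A partition fine enough both for the lower bound [x] and for the Cauchy estimate. *)
    have [|q qst gq] := @fine_partition_exists _ (Num.min d d') s t _ st.
      by rewrite lt_min d0.
    have [/(close q qst) + /(hx q qst)] := gaps_lt_min gq.
    by rewrite ltr_norml; lra.
  have := ub_le_sup (ex_intro _ _ Aup) Alow.
  have := ge_sup (ex_intro _ _ Alow) Aup.
  rewrite !ffunE ler_norml; lra.
apply: le_lt_trans (enorm_le_sum _) _.
apply: le_lt_trans (ler_sum _ (fun j _ => coord j)) _.
rewrite sumr_const -[_ *+ _]mulr_natr.
have -> : eps = e * (2 * #|J|%:R + 1) by rewrite /e divfK // gt_eqF.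
by rewrite mulrAC mulrC mulrDr mulr1 ltrDl.
Qed.

(** Concatenating fine partitions of [0, s] and [s, t] shows that z - w is approximated by sums over
    [s, t], where [rsum_germ_le] holds uniformly in the partition. *)
Lemma sewn_local_le s t w z : 0 <= s -> s <= t -> t <= T ->
  sewn g 0 s w -> sewn g 0 t z ->
  enorm (z - w - g s t) <= sew_const * N * (t - s) `^ theta.
Proof.
move=> s0 st tT gw gz; apply/ler_addgt0Pr => eps eps0.
have [d1 d10 h1] := gw (eps / 2) (divr_gt0 eps0 (ltr0n _ 2)).
have [d2 d20 h2] := gz (eps / 2) (divr_gt0 eps0 (ltr0n _ 2)).
have d0 : 0 < Num.min d1 d2 by rewrite lt_min d10.
have [p ps gp] := fine_partition_exists d0 s0.
have [q qst gq] := fine_partition_exists d0 st.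
have lp : last 0 p = s by have [_ /eqP] := ps.
have [{}gp gp2] := gaps_lt_min gp; have [_ gq2] := gaps_lt_min gq.
have {}h1 := h1 p ps gp.
have {}h2 : enorm (rsum g 0 (p ++ q) - z) < eps / 2.
  apply: h2; first exact: itv_partition_cat qst.
  by rewrite /gaps_lt cat_path -/(gaps_lt _ _ p) gp2 lp.
have [sq /eqP lq] := qst.
have h3 := rsum_germ_le s0 sq; rewrite lq in h3; have {}h3 := h3 tT.
have -> : z - w - g s t = (rsum g s q - g s t)
    + ((rsum g 0 p - w) - (rsum g 0 (p ++ q) - z)).
  by rewrite rsum_cat lp; apply/ffunP => j; rewrite !ffunE; ring.
apply: enormD_trans h3 _.
by apply: le_trans (enormB_trans (ltW h1) (ltW h2)) _; lra.
Qed.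

End Sewing.

(** * Chen's relation and the defect of the germ *)

Section EuclideanAlgebra.
Context {R : realType}.
Implicit Types I J : finType.

Lemma eucD J (u v : euc R J) j : (u + v) j = u j + v j.
Proof. by rewrite ffunE. Qed.

Lemma eucN J (u : euc R J) j : (- u) j = - u j.
Proof. by rewrite ffunE. Qed.

Lemma app0r I J (A : euc R (I * J)%type) : app A 0 = 0.
Proof. by rewrite -(subrr 0) appBr subrr. Qed.

Lemma app20r I J (A : euc R (I * (I * J))%type) : app2 A 0 = 0.
Proof. by rewrite -(subrr 0) app2Br subrr. Qed.

Lemma app_trans I J (A : euc R (I * J)%type) (x : euc R I) (a b : R) :
  enorm A <= a -> enorm x <= b -> enorm (app A x) <= a * b.
Proof.
by move=> Aa xb; apply: le_trans (enorm_app_le _ _) _; rewrite ler_pM ?enorm_ge0.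
Qed.

Lemma app2_trans I J (A : euc R (I * (I * J))%type) (x : euc R (I * I)%type)
    (a b : R) :
  enorm A <= a -> enorm x <= b -> enorm (app2 A x) <= a * b.
Proof.
by move=> Aa xb; apply: le_trans (enorm_app2_le _ _) _; rewrite ler_pM ?enorm_ge0.
Qed.

Lemma app3_trans I J (A : euc R (I * (I * (I * J)))%type)
    (x : euc R (I * I * I)%type) (a b : R) :
  enorm A <= a -> enorm x <= b -> enorm (app3 A x) <= a * b.
Proof.
by move=> Aa xb; apply: le_trans (enorm_app3_le _ _) _; rewrite ler_pM ?enorm_ge0.
Qed.

(** Product rule: A x - A' x' = (A - A') x + A' (x - x'). The next two lemmas do the same on higher
    tensors. *)
Lemma appB_trans I J (A A' : euc R (I * J)%type) (x x' : euc R I)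
    (a a' b b' : R) :
  enorm (A - A') <= a -> enorm x <= b -> enorm A' <= a' -> enorm (x - x') <= b' ->
  enorm (app A x - app A' x') <= a * b + a' * b'.
Proof.
move=> h1 h2 h3 h4.
have -> : app A x - app A' x' = app (A - A') x + app A' (x - x').
  by rewrite appBl appBr addrA subrK.
exact: enormD_trans (app_trans h1 h2) (app_trans h3 h4).
Qed.

Lemma app2B_trans I J (A A' : euc R (I * (I * J))%type)
    (x x' : euc R (I * I)%type) (a a' b b' : R) :
  enorm (A - A') <= a -> enorm x <= b -> enorm A' <= a' -> enorm (x - x') <= b' ->
  enorm (app2 A x - app2 A' x') <= a * b + a' * b'.
Proof.
move=> h1 h2 h3 h4.
have -> : app2 A x - app2 A' x' = app2 (A - A') x + app2 A' (x - x').
  by rewrite app2Bl app2Br addrA subrK.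
exact: enormD_trans (app2_trans h1 h2) (app2_trans h3 h4).
Qed.

Lemma app3B_trans I J (A A' : euc R (I * (I * (I * J)))%type)
    (x x' : euc R (I * I * I)%type) (a a' b b' : R) :
  enorm (A - A') <= a -> enorm x <= b -> enorm A' <= a' -> enorm (x - x') <= b' ->
  enorm (app3 A x - app3 A' x') <= a * b + a' * b'.
Proof.
move=> h1 h2 h3 h4.
have -> : app3 A x - app3 A' x' = app3 (A - A') x + app3 A' (x - x').
  by rewrite app3Bl app3Br addrA subrK.
exact: enormD_trans (app3_trans h1 h2) (app3_trans h3 h4).
Qed.

End EuclideanAlgebra.

(** Only sums and opposites are evaluated at a coordinate, so that values of [app], [app2] and
    [app3] remain atoms for [ring]. *)
Ltac euc_ring :=
  let j := fresh "j" in apply/ffunP => j; rewrite ?(eucD, eucN); ring.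

Section Chen.
Context {R : realType} {I J : finType}.
Variables (T : R) (X : rough R I).
Hypothesis chen : forall s u t : R, 0 <= s -> s <= u -> u <= t -> t <= T ->
  rough_tt X s t = ttmul (rough_tt X s u) (rough_tt X u t).

Section Triangle.
Variables s u t : R.
Hypotheses (s0 : 0 <= s) (su : s <= u) (ut : u <= t) (tT : t <= T).

Lemma chen1 : lev1 X s t = lev1 X s u + lev1 X u t.
Proof.
have := congr1 (@tt1 _ _) (chen s0 su ut tT).
by rewrite /= !scale1r addrC.
Qed.

Lemma chen2 :
  lev2 X s t = lev2 X s u + lev2 X u t + tens11 (lev1 X s u) (lev1 X u t).
Proof.
have := congr1 (@tt2 _ _) (chen s0 su ut tT).
by rewrite /= !scale1r => ->; rewrite addrC addrA.
Qed.

Lemma chen3 :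
  lev3 X s t = lev3 X s u + lev3 X u t + tens12 (lev1 X s u) (lev2 X u t)
    + tens21 (lev2 X s u) (lev1 X u t).
Proof.
have := congr1 (@tt3 _ _) (chen s0 su ut tT).
by rewrite /= !scale1r => ->; rewrite addrC !addrA.
Qed.

Lemma germ_defectE (Y : ctriple R I (I * J)%type) :
  germ X Y s t - germ X Y s u - germ X Y u t =
    - (app (sharp X Y s u) (lev1 X u t) + app2 (ssharp X Y s u) (lev2 X u t)
       + app3 (cp2 Y u - cp2 Y s) (lev3 X u t)).
Proof.
rewrite /germ chen1 chen2 chen3 /sharp /ssharp.
rewrite !(appD, app2D, app3D, appBl, app2Bl, app3Bl).
rewrite app_app app_app2 app2_app.
euc_ring.
Qed.

End Triangle.

Section Diagonal.
Variable s : R.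
Hypotheses (s0 : 0 <= s) (sT : s <= T).

(** Chen's relation at s = u = t, level by level. The diagonal values are needed because the Hölder
    suprema range over s < t, while [incr_le] includes s = t. *)
Lemma lev1_diag : lev1 X s s = 0.
Proof.
apply: (@addrI _ (lev1 X s s)).
by rewrite addr0 -(chen1 s0 (lexx s) (lexx s) sT).
Qed.

Lemma lev2_diag : lev2 X s s = 0.
Proof.
apply: (@addrI _ (lev2 X s s)).
rewrite addr0 [RHS](chen2 s0 (lexx s) (lexx s) sT) lev1_diag.
have -> : tens11 0 0 = 0 :> euc R (I * I)%type.
  by apply/ffunP => p; rewrite !ffunE mulr0.
by rewrite addr0.
Qed.

Lemma lev3_diag : lev3 X s s = 0.
Proof.
apply: (@addrI _ (lev3 X s s)).
rewrite addr0 [RHS](chen3 s0 (lexx s) (lexx s) sT) lev1_diag lev2_diag.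
have -> : tens12 0 0 = 0 :> euc R (I * I * I)%type.
  by apply/ffunP => p; rewrite !ffunE mulr0.
have -> : tens21 0 0 = 0 :> euc R (I * I * I)%type.
  by apply/ffunP => p; rewrite !ffunE mulr0.
by rewrite !addr0.
Qed.

Lemma sharp_diag (L : finType) (Y : ctriple R I L) : sharp X Y s s = 0.
Proof. by rewrite /sharp lev1_diag lev2_diag app0r app20r !subrr. Qed.

Lemma ssharp_diag (L : finType) (Y : ctriple R I L) : ssharp X Y s s = 0.
Proof. by rewrite /ssharp lev1_diag app0r !subrr. Qed.

End Diagonal.

End Chen.

(** * Hölder seminorms as real bounds on increments *)

Section HolderBounds.
Context {R : realType}.
Implicit Types (I J : finType) (alpha T c : R).

(** The order k * alpha is written as a k-th power, so that estimates become polynomial inequalities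
    in q = (t - s)^alpha. *)
Definition incr_le J alpha T (k : nat) c (psi : R -> R -> euc R J) : Prop :=
  forall s t, 0 <= s -> s <= t -> t <= T ->
    enorm (psi s t) <= c * (t - s) `^ alpha ^+ k.

Lemma powR_natM (h alpha : R) (k : nat) : h `^ (k%:R * alpha) = h `^ alpha ^+ k.
Proof. by rewrite mulrC powRrM powR_mulrn ?powR_ge0. Qed.

Lemma holder2_ub J alpha T (k : nat) c (psi : R -> R -> euc R J) :
  incr_le alpha T k c psi -> (holder2 T (k%:R * alpha) psi <= c%:E)%E.
Proof.
move=> h; apply: ge_ereal_sup => _ [s [t [s0 st tT ->]]].
rewrite lee_fin powR_natM ler_pdivrMr; last by rewrite exprn_gt0 ?powR_gt0 ?subr_gt0.
by apply: h => //; exact: ltW.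
Qed.

Lemma holder2_incr_le J alpha T (k : nat) c (psi : R -> R -> euc R J) :
  0 <= c -> (forall s, 0 <= s -> s <= T -> psi s s = 0) ->
  (holder2 T (k%:R * alpha) psi <= c%:E)%E -> incr_le alpha T k c psi.
Proof.
move=> c0 psi0 h s t s0; rewrite le_eqVlt => /orP[/eqP <- sT|st tT].
  by rewrite psi0 // enorm0 mulr_ge0 ?exprn_ge0 ?powR_ge0.
rewrite -powR_natM -ler_pdivrMr; last by rewrite powR_gt0 ?subr_gt0.
rewrite -lee_fin; apply: le_trans h; apply: ereal_sup_ubound.
by exists s, t.
Qed.

(** The pair (0, T) makes the supremum range over a nonempty set; for T = 0 it would be -oo.
    Nonnegativity is what permits bounding the summands of the norms separately. *)
Lemma holder2_ge0 J alpha T (psi : R -> R -> euc R J) :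
  0 < T -> (0 <= holder2 T alpha psi)%E.
Proof.
move=> T0; apply: (@le_trans _ _ (enorm (psi 0 T) / (T - 0) `^ alpha)%:E).
  by rewrite lee_fin divr_ge0 ?enorm_ge0 ?powR_ge0.
by apply: ereal_sup_ubound; exists 0, T.
Qed.

End HolderBounds.

(** * Estimates for the integral *)

Section Estimates.
Context {R : realType} {I J : finType}.
Variables (alpha T K : R).
Hypothesis alpha_gt : 4^-1 < alpha.
Implicit Types (X : rough R I) (Y : ctriple R I (I * J)%type) (r d : R).

(** Real form of [bounded_data] with a single constant. Below, [K] also dominates 1, the powers
    h^alpha for h <= T, and the sewing constant, so that all constants are monomials in [K]. *)
Record bounded_by X Y : Prop := BoundedBy {
  bb_chen : forall s u t : R, 0 <= s -> s <= u -> u <= t -> t <= T ->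
    rough_tt X s t = ttmul (rough_tt X s u) (rough_tt X u t);
  bb_lev1 : incr_le alpha T 1 K (lev1 X);
  bb_lev2 : incr_le alpha T 2 K (lev2 X);
  bb_lev3 : incr_le alpha T 3 K (lev3 X);
  bb_cp2 : incr_le alpha T 1 K (fun s t => cp2 Y t - cp2 Y s);
  bb_ssharp : incr_le alpha T 2 K (ssharp X Y);
  bb_sharp : incr_le alpha T 3 K (sharp X Y);
  bb_cp0_0 : enorm (cp0 Y 0) <= K;
  bb_cp1_0 : enorm (cp1 Y 0) <= K;
  bb_cp2_0 : enorm (cp2 Y 0) <= K }.

(* In the application r is the data distance and d = r / T^alpha. *)
Record close_by r d X X' Y Y' : Prop := CloseBy {
  cb_r : 0 <= r;
  cb_d : 0 <= d;
  cb_dr : forall h : R, 0 <= h -> h <= T -> d * h `^ alpha <= r;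
  cb_lev1 : incr_le alpha T 1 r (fun s t => lev1 X s t - lev1 X' s t);
  cb_lev2 : incr_le alpha T 2 r (fun s t => lev2 X s t - lev2 X' s t);
  cb_lev3 : incr_le alpha T 3 r (fun s t => lev3 X s t - lev3 X' s t);
  cb_cp2 : incr_le alpha T 1 d
    (fun s t => (cp2 Y t - cp2 Y' t) - (cp2 Y s - cp2 Y' s));
  cb_ssharp : incr_le alpha T 2 d (fun s t => ssharp X Y s t - ssharp X' Y' s t);
  cb_sharp : incr_le alpha T 3 d (fun s t => sharp X Y s t - sharp X' Y' s t);
  cb_cp0_0 : enorm (cp0 Y 0 - cp0 Y' 0) <= r;
  cb_cp1_0 : enorm (cp1 Y 0 - cp1 Y' 0) <= r;
  cb_cp2_0 : enorm (cp2 Y 0 - cp2 Y' 0) <= r }.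

Hypothesis K_ge1 : 1 <= K.
Hypothesis powR_le : forall h : R, 0 <= h -> h <= T -> h `^ alpha <= K.
Hypothesis const_le : sew_const (4%:R * alpha) <= K.

Let K_ge0 : 0 <= K. Proof. exact: le_trans K_ge1. Qed.

Let theta_gt1 : 1 < 4%:R * alpha.
Proof. by move: alpha_gt; lra. Qed.

Let alpha_gt0 : 0 < alpha.
Proof. by move: alpha_gt; lra. Qed.

Let KX_le (i j : nat) : (i <= j)%N -> K ^+ i <= K ^+ j.
Proof. exact: ler_weXn2l. Qed.

(** * A priori bounds for one rough path and one controlled path *)

Section Single.
Variables (X : rough R I) (Y : ctriple R I (I * J)%type).
Hypothesis bXY : bounded_by X Y.

(** The data bound only the values at 0 and the remainders; here and in the next two lemmas the
    values at s are recovered by expanding from 0. *)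
Lemma cp2_le s : 0 <= s -> s <= T -> enorm (cp2 Y s) <= 2 * K ^+ 2.
Proof.
move=> s0 sT; have h := bb_cp2 bXY (lexx 0) s0 sT.
rewrite subr0 in h; have q0 := powR_ge0 s alpha; have qK := powR_le s0 sT.
have -> : cp2 Y s = (cp2 Y s - cp2 Y 0) + cp2 Y 0 by rewrite subrK.
apply: le_trans (enormD_trans h (bb_cp2_0 bXY)) _.
have := ler_wpM2l K_ge0 qK; have := @KX_le 1 2 isT.
by move: (s `^ alpha) => q; lra.
Qed.

Lemma cp1_le s : 0 <= s -> s <= T -> enorm (cp1 Y s) <= 3 * K ^+ 3.
Proof.
move=> s0 sT; have h := bb_ssharp bXY (lexx 0) s0 sT.
have h1 := bb_lev1 bXY (lexx 0) s0 sT.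
rewrite subr0 in h h1; have q0 := powR_ge0 s alpha; have qK := powR_le s0 sT.
have -> : cp1 Y s = cp1 Y 0 + app (cp2 Y 0) (lev1 X 0 s) + ssharp X Y 0 s.
  by rewrite /ssharp; euc_ring.
apply: le_trans
  (enormD_trans (enormD_trans (bb_cp1_0 bXY) (app_trans (bb_cp2_0 bXY) h1)) h) _.
have := @KX_le 1 3 isT.
have : K * (K * s `^ alpha) <= K * (K * K) by rewrite !ler_wpM2l.
have : K * s `^ alpha ^+ 2 <= K * (K ^+ 2).
  by rewrite ler_wpM2l // lerXn2r ?nnegrE.
by move: (s `^ alpha) => q; lra.
Qed.

Lemma cp0_le s : 0 <= s -> s <= T -> enorm (cp0 Y s) <= 4 * K ^+ 4.
Proof.
move=> s0 sT; have h := bb_sharp bXY (lexx 0) s0 sT.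
have h1 := bb_lev1 bXY (lexx 0) s0 sT; have h2 := bb_lev2 bXY (lexx 0) s0 sT.
rewrite subr0 in h h1 h2; have q0 := powR_ge0 s alpha; have qK := powR_le s0 sT.
have -> : cp0 Y s = cp0 Y 0 + app (cp1 Y 0) (lev1 X 0 s)
    + app2 (cp2 Y 0) (lev2 X 0 s) + sharp X Y 0 s.
  by rewrite /sharp; euc_ring.
apply: le_trans (enormD_trans (enormD_trans (enormD_trans (bb_cp0_0 bXY)
  (app_trans (bb_cp1_0 bXY) h1)) (app2_trans (bb_cp2_0 bXY) h2)) h) _.
have := @KX_le 1 4 isT; have := @KX_le 3 4 isT.
have : K * (K * s `^ alpha) <= K * (K * K) by rewrite !ler_wpM2l.
have : K * (K * s `^ alpha ^+ 2) <= K * (K * K ^+ 2).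
  by rewrite !ler_wpM2l // lerXn2r ?nnegrE.
have : K * s `^ alpha ^+ 3 <= K * (K ^+ 3).
  by rewrite ler_wpM2l // lerXn2r ?nnegrE.
by move: (s `^ alpha) => q; lra.
Qed.

Lemma germ_defect_le s u t : 0 <= s -> s <= u -> u <= t -> t <= T ->
  enorm (germ X Y s t - germ X Y s u - germ X Y u t)
    <= 3 * K ^+ 2 * (t - s) `^ (4%:R * alpha).
Proof.
move=> s0 su ut tT; rewrite (germ_defectE (bb_chen bXY) s0 su ut tT) enormN.
have uT := le_trans ut tT; have u0 := le_trans s0 su.
rewrite powR_natM; have [q0 q1] := (powR_ge0 (u - s) alpha, powR_ge0 (t - u) alpha).
have h1 : (u - s) `^ alpha <= (t - s) `^ alpha.
  by apply: ge0_ler_powR; rewrite ?nnegrE ?(ltW alpha_gt0) //; lra.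
have h2 : (t - u) `^ alpha <= (t - s) `^ alpha.
  by apply: ge0_ler_powR; rewrite ?nnegrE ?(ltW alpha_gt0) //; lra.
apply: le_trans (enormD_trans (enormD_trans
  (app_trans (bb_sharp bXY s0 su uT) (bb_lev1 bXY u0 ut tT))
  (app2_trans (bb_ssharp bXY s0 su uT) (bb_lev2 bXY u0 ut tT)))
  (app3_trans (bb_cp2 bXY s0 su uT) (bb_lev3 bXY u0 ut tT))) _.
move: ((t - s) `^ alpha) ((u - s) `^ alpha) ((t - u) `^ alpha) q0 q1 h1 h2.
move=> q p1 p2 q0 q1 h1 h2.
(* The three terms of the defect have orders (3, 1), (2, 2) and (1, 3), each of total order 4. *)
have aux (i j : nat) : (i + j)%N = 4%N ->
    K * p1 ^+ i * (K * p2 ^+ j) <= K ^+ 2 * q ^+ 4.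
  move=> ij; have -> : K * p1 ^+ i * (K * p2 ^+ j) = K ^+ 2 * (p1 ^+ i * p2 ^+ j).
    by ring.
  rewrite ler_wpM2l ?exprn_ge0 // -ij exprD ler_pM ?exprn_ge0 //.
    by rewrite lerXn2r ?nnegrE // (le_trans q0).
  by rewrite lerXn2r ?nnegrE // (le_trans q0).
have := aux 3%N 1%N erefl; have := aux 2%N 2%N erefl; have := aux 1%N 3%N erefl.
lra.
Qed.

Lemma germ_sewn_exists t : 0 <= t -> t <= T -> exists z, sewn (germ X Y) 0 t z.
Proof.
move=> t0 tT; apply: (sewn_exists theta_gt1 _ germ_defect_le) => //.
by rewrite mulr_ge0 ?exprn_ge0.
Qed.

Variable z : R -> euc R J.
Hypothesis z_sewn : forall t, 0 <= t -> t <= T -> sewn (germ X Y) 0 t (z t).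
Let Z := CTriple z (cp0 Y) (cp1 Y).

Lemma integral_germ_le s t : 0 <= s -> s <= t -> t <= T ->
  enorm (z t - z s - germ X Y s t) <= 3 * K ^+ 3 * (t - s) `^ alpha ^+ 4.
Proof.
move=> s0 st tT.
have N0 : 0 <= 3 * K ^+ 2 by rewrite mulr_ge0 ?exprn_ge0.
apply: le_trans (sewn_local_le theta_gt1 N0 germ_defect_le s0 st tT
  (z_sewn s0 (le_trans st tT)) (z_sewn (le_trans s0 st) tT)) _.
rewrite powR_natM ler_wpM2r ?exprn_ge0 ?powR_ge0 //.
have -> : 3 * K ^+ 3 = K * (3 * K ^+ 2) by ring.
by rewrite ler_wpM2r.
Qed.

(** The sharp remainder of [Z] subtracts only the first two terms of the germ; the third is added
    back. *)
Lemma integral_sharpE s t :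
  sharp X Z s t = (z t - z s - germ X Y s t) + app3 (cp2 Y s) (lev3 X s t).
Proof. by rewrite /sharp /germ /=; euc_ring. Qed.

Lemma integral_ssharpE s t :
  ssharp X Z s t = app2 (cp2 Y s) (lev2 X s t) + sharp X Y s t.
Proof. by rewrite /sharp /ssharp /=; euc_ring. Qed.

Lemma integral_incrE s t :
  z t - z s = app (cp0 Y s) (lev1 X s t) + app2 (cp1 Y s) (lev2 X s t)
    + sharp X Z s t.
Proof. by rewrite /sharp /=; euc_ring. Qed.

Lemma cp1_incrE s t :
  cp1 Y t - cp1 Y s = app (cp2 Y s) (lev1 X s t) + ssharp X Y s t.
Proof. by rewrite /ssharp /=; euc_ring. Qed.

Lemma integral_sharp_le : incr_le alpha T 3 (5 * K ^+ 4) (sharp X Z).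
Proof.
move=> s t s0 st tT; have sT := le_trans st tT.
rewrite integral_sharpE.
apply: le_trans (enormD_trans (integral_germ_le s0 st tT)
  (app3_trans (cp2_le s0 sT) (bb_lev3 bXY s0 st tT))) _.
have : (t - s) `^ alpha <= K by apply: powR_le; lra.
move: ((t - s) `^ alpha) (powR_ge0 (t - s) alpha) => q q0 qK.
have q3 : 0 <= q ^+ 3 by rewrite exprn_ge0.
have : 3 * K ^+ 3 * q ^+ 3 * q <= 3 * K ^+ 3 * q ^+ 3 * K.
  by rewrite ler_wpM2l // !mulr_ge0 ?exprn_ge0.
have := ler_wpM2r q3 (@KX_le 3 4 isT).
lra.
Qed.

Lemma integral_ssharp_le : incr_le alpha T 2 (3 * K ^+ 4) (ssharp X Z).
Proof.
move=> s t s0 st tT; have sT := le_trans st tT.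
rewrite integral_ssharpE.
apply: le_trans (enormD_trans (app2_trans (cp2_le s0 sT) (bb_lev2 bXY s0 st tT))
  (bb_sharp bXY s0 st tT)) _.
have : (t - s) `^ alpha <= K by apply: powR_le; lra.
move: ((t - s) `^ alpha) (powR_ge0 (t - s) alpha) => q q0 qK.
have q2 : 0 <= q ^+ 2 by rewrite exprn_ge0.
have : K * q ^+ 2 * q <= K * q ^+ 2 * K by rewrite ler_wpM2l // mulr_ge0.
have := ler_wpM2r q2 (@KX_le 3 4 isT); have := ler_wpM2r q2 (@KX_le 2 4 isT).
lra.
Qed.

Lemma integral_incr_le :
  incr_le alpha T 1 (12 * K ^+ 6) (fun s t => z t - z s).
Proof.
move=> s t s0 st tT; have sT := le_trans st tT.
rewrite integral_incrE.
apply: le_trans (enormD_trans (enormD_trans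
   (app_trans (cp0_le s0 sT) (bb_lev1 bXY s0 st tT))
   (app2_trans (cp1_le s0 sT) (bb_lev2 bXY s0 st tT)))
  (integral_sharp_le s0 st tT)) _.
have : (t - s) `^ alpha <= K by apply: powR_le; lra.
move: ((t - s) `^ alpha) (powR_ge0 (t - s) alpha) => q q0 qK.
(* Since q <= K, the higher powers of q are lowered to the order 1 required here. *)
have q2 : q ^+ 2 <= K * q by rewrite expr2 ler_wpM2r.
have q3 : q ^+ 3 <= K ^+ 2 * q.
  by rewrite exprSr ler_wpM2r // lerXn2r ?nnegrE.
have := ler_wpM2r q0 (@KX_le 5 6 isT).
have : 3 * K ^+ 3 * K * q ^+ 2 <= 3 * K ^+ 3 * K * (K * q).
  by rewrite ler_wpM2l // !mulr_ge0 ?exprn_ge0.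
have : 5 * K ^+ 4 * q ^+ 3 <= 5 * K ^+ 4 * (K ^+ 2 * q).
  by rewrite ler_wpM2l // mulr_ge0 ?exprn_ge0.
lra.
Qed.

End Single.

(** * Differences between two sets of data *)

Section Difference.
Variables (X X' : rough R I) (Y Y' : ctriple R I (I * J)%type) (r d : R).
Hypotheses (bXY : bounded_by X Y) (bXY' : bounded_by X' Y').
Hypothesis close : close_by r d X X' Y Y'.

Let r_ge0 : 0 <= r := cb_r close.
Let d_ge0 : 0 <= d := cb_d close.

(** Expansion from 0 as in [cp2_le], now for differences. Every occurrence of [d] comes with a
    factor s^alpha, which turns it into [r]; the same holds in the next two lemmas. *)
Lemma cp2_close s : 0 <= s -> s <= T -> enorm (cp2 Y s - cp2 Y' s) <= 2 * r.
Proof.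
move=> s0 sT; have h := cb_cp2 close (lexx 0) s0 sT; rewrite subr0 in h.
rewrite -[X in enorm X](subrK (cp2 Y 0 - cp2 Y' 0)).
apply: le_trans (enormD_trans h (cb_cp2_0 close)) _.
by have := cb_dr close s0 sT; rewrite expr1; lra.
Qed.

Lemma cp1_close s : 0 <= s -> s <= T ->
  enorm (cp1 Y s - cp1 Y' s) <= 4 * K ^+ 2 * r.
Proof.
move=> s0 sT; have h := cb_ssharp close (lexx 0) s0 sT.
have h1 := bb_lev1 bXY (lexx 0) s0 sT; have h2 := cb_lev1 close (lexx 0) s0 sT.
rewrite subr0 in h h1 h2.
have -> : cp1 Y s - cp1 Y' s = (cp1 Y 0 - cp1 Y' 0)
    + (app (cp2 Y 0) (lev1 X 0 s) - app (cp2 Y' 0) (lev1 X' 0 s))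
    + (ssharp X Y 0 s - ssharp X' Y' 0 s).
  by rewrite /ssharp; euc_ring.
apply: le_trans (enormD_trans (enormD_trans (cb_cp1_0 close)
  (appB_trans (cb_cp2_0 close) h1 (bb_cp2_0 bXY') h2)) h) _.
have := cb_dr close s0 sT; have := powR_le s0 sT.
move: (s `^ alpha) (powR_ge0 s alpha) => q q0 qK dq.
have rK : r * K * q <= r * K * K by rewrite ler_wpM2l ?mulr_ge0.
have dq2 : d * q * q <= r * K by rewrite ler_pM ?mulr_ge0.
have := ler_wpM2l r_ge0 (@KX_le 0 2 isT); have := ler_wpM2l r_ge0 (@KX_le 1 2 isT).
lra.
Qed.

Lemma cp0_close s : 0 <= s -> s <= T ->
  enorm (cp0 Y s - cp0 Y' s) <= 6 * K ^+ 3 * r.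
Proof.
move=> s0 sT; have h := cb_sharp close (lexx 0) s0 sT.
have h1 := bb_lev1 bXY (lexx 0) s0 sT; have h2 := cb_lev1 close (lexx 0) s0 sT.
have h3 := bb_lev2 bXY (lexx 0) s0 sT; have h4 := cb_lev2 close (lexx 0) s0 sT.
rewrite subr0 in h h1 h2 h3 h4.
have -> : cp0 Y s - cp0 Y' s = (cp0 Y 0 - cp0 Y' 0)
    + (app (cp1 Y 0) (lev1 X 0 s) - app (cp1 Y' 0) (lev1 X' 0 s))
    + (app2 (cp2 Y 0) (lev2 X 0 s) - app2 (cp2 Y' 0) (lev2 X' 0 s))
    + (sharp X Y 0 s - sharp X' Y' 0 s).
  by rewrite /sharp; euc_ring.
apply: le_trans (enormD_trans (enormD_trans (enormD_trans (cb_cp0_0 close)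
  (appB_trans (cb_cp1_0 close) h1 (bb_cp1_0 bXY') h2))
  (app2B_trans (cb_cp2_0 close) h3 (bb_cp2_0 bXY') h4)) h) _.
have := cb_dr close s0 sT; have := powR_le s0 sT.
move: (s `^ alpha) (powR_ge0 s alpha) => q q0 qK dq.
have q2 : q ^+ 2 <= K ^+ 2 by rewrite lerXn2r ?nnegrE.
have rK : r * K * q <= r * K * K by rewrite ler_wpM2l ?mulr_ge0.
have rK2 : r * K * q ^+ 2 <= r * K * K ^+ 2 by rewrite ler_wpM2l ?mulr_ge0.
have dq2 : d * q * q ^+ 2 <= r * K ^+ 2 by rewrite ler_pM ?mulr_ge0 ?exprn_ge0.
have := ler_wpM2l r_ge0 (@KX_le 0 3 isT); have := ler_wpM2l r_ge0 (@KX_le 2 3 isT).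
lra.
Qed.

(** Product rule in each term of [germ_defectE]: a difference of the [Y] factors costs [d], a
    difference of levels of the rough paths costs [r], and the remaining factor costs [K]. *)
Lemma germB_defect_le s u t : 0 <= s -> s <= u -> u <= t -> t <= T ->
  enorm ((germ X Y s t - germ X' Y' s t) - (germ X Y s u - germ X' Y' s u)
      - (germ X Y u t - germ X' Y' u t))
    <= 3 * K * (d + r) * (t - s) `^ (4%:R * alpha).
Proof.
move=> s0 su ut tT.
have uT := le_trans ut tT; have u0 := le_trans s0 su.
have -> : (germ X Y s t - germ X' Y' s t) - (germ X Y s u - germ X' Y' s u)
      - (germ X Y u t - germ X' Y' u t)
    = (germ X Y s t - germ X Y s u - germ X Y u t)
      - (germ X' Y' s t - germ X' Y' s u - germ X' Y' u t) by euc_ring.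
rewrite (germ_defectE (bb_chen bXY) s0 su ut tT).
rewrite (germ_defectE (bb_chen bXY') s0 su ut tT) -opprD enormN.
have h1 : enorm ((cp2 Y u - cp2 Y s) - (cp2 Y' u - cp2 Y' s))
    <= d * (u - s) `^ alpha ^+ 1.
  have := cb_cp2 close s0 su uT.
  by congr (enorm _ <= _); euc_ring.
have h2 := cb_ssharp close s0 su uT; have h3 := cb_sharp close s0 su uT.
have -> : forall a b c a' b' c' : euc R J,
    a + b + c - (a' + b' + c') = (a - a') + (b - b') + (c - c').
  by move=> *; euc_ring.
apply: le_trans (enormD_trans (enormD_trans
  (appB_trans h3 (bb_lev1 bXY u0 ut tT) (bb_sharp bXY' s0 su uT)
     (cb_lev1 close u0 ut tT))
  (app2B_trans h2 (bb_lev2 bXY u0 ut tT) (bb_ssharp bXY' s0 su uT)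
     (cb_lev2 close u0 ut tT)))
  (app3B_trans h1 (bb_lev3 bXY u0 ut tT) (bb_cp2 bXY' s0 su uT)
     (cb_lev3 close u0 ut tT))) _.
rewrite powR_natM; have [q0 q1] := (powR_ge0 (u - s) alpha, powR_ge0 (t - u) alpha).
have i1 : (u - s) `^ alpha <= (t - s) `^ alpha.
  by apply: ge0_ler_powR; rewrite ?nnegrE ?(ltW alpha_gt0) //; lra.
have i2 : (t - u) `^ alpha <= (t - s) `^ alpha.
  by apply: ge0_ler_powR; rewrite ?nnegrE ?(ltW alpha_gt0) //; lra.
move: ((t - s) `^ alpha) ((u - s) `^ alpha) ((t - u) `^ alpha) q0 q1 i1 i2.
move=> q p1 p2 q0 q1 i1 i2.
have aux (i j : nat) : (i + j)%N = 4%N ->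
    d * p1 ^+ i * (K * p2 ^+ j) + K * p1 ^+ i * (r * p2 ^+ j)
      <= K * (d + r) * q ^+ 4.
  move=> ij.
  have -> : d * p1 ^+ i * (K * p2 ^+ j) + K * p1 ^+ i * (r * p2 ^+ j)
      = K * (d + r) * (p1 ^+ i * p2 ^+ j) by ring.
  rewrite ler_wpM2l ?mulr_ge0 ?addr_ge0 // -ij exprD ler_pM ?exprn_ge0 //.
    by rewrite lerXn2r ?nnegrE // (le_trans q0).
  by rewrite lerXn2r ?nnegrE // (le_trans q0).
have := aux 3%N 1%N erefl; have := aux 2%N 2%N erefl; have := aux 1%N 3%N erefl.
lra.
Qed.

Variables z z' : R -> euc R J.
Hypothesis z_sewn : forall t, 0 <= t -> t <= T -> sewn (germ X Y) 0 t (z t).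
Hypothesis z'_sewn : forall t, 0 <= t -> t <= T -> sewn (germ X' Y') 0 t (z' t).
Let Z := CTriple z (cp0 Y) (cp1 Y).
Let Z' := CTriple z' (cp0 Y') (cp1 Y').

(* The sewing remainder has order 4 alpha where 3 alpha is needed: the spare  *)
(* factor (t - s)^alpha turns d into r.                                       *)
Lemma integral_germB_le s t : 0 <= s -> s <= t -> t <= T ->
  enorm ((z t - z s - germ X Y s t) - (z' t - z' s - germ X' Y' s t))
    <= 6 * K ^+ 3 * r * (t - s) `^ alpha ^+ 3.
Proof.
move=> s0 st tT; have sT := le_trans st tT; have t0 := le_trans s0 st.
have N0 : 0 <= 3 * K * (d + r) by rewrite !mulr_ge0 ?addr_ge0.
have -> : (z t - z s - germ X Y s t) - (z' t - z' s - germ X' Y' s t)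
    = (z t - z' t) - (z s - z' s) - (germ X Y s t - germ X' Y' s t).
  by euc_ring.
apply: le_trans (sewn_local_le theta_gt1 N0 germB_defect_le s0 st tT
  (sewnB (z_sewn s0 sT) (z'_sewn s0 sT)) (sewnB (z_sewn t0 tT) (z'_sewn t0 tT))) _.
have h0 : 0 <= t - s by lra.
have hT : t - s <= T by lra.
have := powR_le h0 hT; have := cb_dr close h0 hT; rewrite powR_natM.
move: ((t - s) `^ alpha) (powR_ge0 (t - s) alpha) => q q0 dq qK.
have dr : (d + r) * q <= 2 * K * r.
  have := ler_wpM2l r_ge0 qK; have := ler_wpM2r r_ge0 K_ge1; lra.
have -> : sew_const (4%:R * alpha) * (3 * K * (d + r)) * q ^+ 4
    = sew_const (4%:R * alpha) * (3 * K * ((d + r) * q) * q ^+ 3) by ring.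
have -> : 6 * K ^+ 3 * r * q ^+ 3 = K * (3 * K * (2 * K * r) * q ^+ 3) by ring.
apply: ler_pM => //; first exact: ltW (sew_const_gt0 theta_gt1).
  by rewrite !mulr_ge0 ?exprn_ge0 ?addr_ge0.
by rewrite ler_wpM2r ?exprn_ge0 // ler_wpM2l // mulr_ge0.
Qed.

Lemma integral_sharp_close :
  incr_le alpha T 3 (27 * K ^+ 5 * r)
    (fun s t => sharp X Z s t - sharp X' Z' s t).
Proof.
move=> s t s0 st tT; have sT := le_trans st tT.
rewrite !integral_sharpE.
have -> : forall a b a' b' : euc R J, a + b - (a' + b') = (a - a') + (b - b').
  by move=> *; euc_ring.
apply: le_trans (enormD_trans (integral_germB_le s0 st tT)
  (app3B_trans (cp2_close s0 sT) (bb_lev3 bXY s0 st tT) (cp2_le bXY' s0 sT)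
     (cb_lev3 close s0 st tT))) _.
move: ((t - s) `^ alpha) (powR_ge0 (t - s) alpha) => q q0.
have rq : 0 <= r * q ^+ 3 by rewrite mulr_ge0 ?exprn_ge0.
have := ler_wpM2r rq (@KX_le 1 5 isT); have := ler_wpM2r rq (@KX_le 2 5 isT).
have := ler_wpM2r rq (@KX_le 3 5 isT).
have : 0 <= K ^+ 5 * (r * q ^+ 3) by rewrite mulr_ge0 ?exprn_ge0.
lra.
Qed.

(** The sharp remainder of [Y] has order 3 with constant [d], but order 2 suffices here; the spare
    factor (t - s)^alpha turns [d] into [r]. *)
Lemma integral_ssharp_close :
  incr_le alpha T 2 (27 * K ^+ 5 * r)
    (fun s t => ssharp X Z s t - ssharp X' Z' s t).
Proof.
move=> s t s0 st tT; have sT := le_trans st tT.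
rewrite !integral_ssharpE.
have -> : forall a b a' b' : euc R (I * J)%type,
    a + b - (a' + b') = (a - a') + (b - b').
  by move=> *; euc_ring.
apply: le_trans (enormD_trans
  (app2B_trans (cp2_close s0 sT) (bb_lev2 bXY s0 st tT) (cp2_le bXY' s0 sT)
     (cb_lev2 close s0 st tT)) (cb_sharp close s0 st tT)) _.
have : d * (t - s) `^ alpha <= r by apply: (cb_dr close); lra.
move: ((t - s) `^ alpha) (powR_ge0 (t - s) alpha) => q q0 dq.
have rq : 0 <= r * q ^+ 2 by rewrite mulr_ge0 ?exprn_ge0.
have : d * q * q ^+ 2 <= r * q ^+ 2 by rewrite ler_wpM2r ?exprn_ge0.
have := ler_wpM2r rq (@KX_le 1 5 isT); have := ler_wpM2r rq (@KX_le 2 5 isT).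
have := ler_wpM2r rq (@KX_le 0 5 isT).
have : 0 <= K ^+ 5 * (r * q ^+ 2) by rewrite mulr_ge0 ?exprn_ge0.
lra.
Qed.

(** The top component of [Z] is [cp1 Y]. Its increment splits by [cp1_incrE], and the second-order
    remainder has a factor (t - s)^alpha to spare. *)
Lemma integral_cp2_close :
  incr_le alpha T 1 (27 * K ^+ 5 * r)
    (fun s t => (cp1 Y t - cp1 Y' t) - (cp1 Y s - cp1 Y' s)).
Proof.
move=> s t s0 st tT; have sT := le_trans st tT.
have -> : (cp1 Y t - cp1 Y' t) - (cp1 Y s - cp1 Y' s)
    = (cp1 Y t - cp1 Y s) - (cp1 Y' t - cp1 Y' s) by euc_ring.
rewrite (cp1_incrE X) (cp1_incrE X').
have -> : forall a b a' b' : euc R (I * (I * J))%type,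
    a + b - (a' + b') = (a - a') + (b - b').
  by move=> *; euc_ring.
apply: le_trans (enormD_trans
  (appB_trans (cp2_close s0 sT) (bb_lev1 bXY s0 st tT) (cp2_le bXY' s0 sT)
     (cb_lev1 close s0 st tT)) (cb_ssharp close s0 st tT)) _.
have : d * (t - s) `^ alpha <= r by apply: (cb_dr close); lra.
move: ((t - s) `^ alpha) (powR_ge0 (t - s) alpha) => q q0 dq.
have rq : 0 <= r * q by rewrite mulr_ge0.
have : d * q * q <= r * q by rewrite ler_wpM2r.
have := ler_wpM2r rq (@KX_le 1 5 isT); have := ler_wpM2r rq (@KX_le 2 5 isT).
have := ler_wpM2r rq (@KX_le 0 5 isT).
have : 0 <= K ^+ 5 * (r * q) by rewrite mulr_ge0 ?exprn_ge0.
lra.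
Qed.

Lemma integral_close :
  incr_le alpha T 1 (54 * K ^+ 7 * r)
    (fun s t => (z t - z' t) - (z s - z' s)).
Proof.
move=> s t s0 st tT; have sT := le_trans st tT.
have -> : (z t - z' t) - (z s - z' s) = (z t - z s) - (z' t - z' s) by euc_ring.
rewrite (integral_incrE X Y) (integral_incrE X' Y').
have -> : forall a b c a' b' c' : euc R J,
    a + b + c - (a' + b' + c') = (a - a') + (b - b') + (c - c').
  by move=> *; euc_ring.
apply: le_trans (enormD_trans (enormD_trans
  (appB_trans (cp0_close s0 sT) (bb_lev1 bXY s0 st tT) (cp0_le bXY' s0 sT)
     (cb_lev1 close s0 st tT))
  (app2B_trans (cp1_close s0 sT) (bb_lev2 bXY s0 st tT) (cp1_le bXY' s0 sT)
     (cb_lev2 close s0 st tT))) (integral_sharp_close s0 st tT)) _.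
have : (t - s) `^ alpha <= K by apply: powR_le; lra.
move: ((t - s) `^ alpha) (powR_ge0 (t - s) alpha) => q q0 qK.
have rq : 0 <= r * q by rewrite mulr_ge0.
have q2 : q ^+ 2 <= K * q by rewrite expr2 ler_wpM2r.
have q3 : q ^+ 3 <= K ^+ 2 * q.
  by rewrite exprSr ler_wpM2r // lerXn2r ?nnegrE.
have : 7 * K ^+ 3 * r * q ^+ 2 <= 7 * K ^+ 3 * r * (K * q).
  by rewrite ler_wpM2l // !mulr_ge0 ?exprn_ge0.
have : 27 * K ^+ 5 * r * q ^+ 3 <= 27 * K ^+ 5 * r * (K ^+ 2 * q).
  by rewrite ler_wpM2l // !mulr_ge0 ?exprn_ge0.
have := ler_wpM2r rq (@KX_le 4 7 isT).
have : 0 <= K ^+ 7 * (r * q) by rewrite mulr_ge0 ?exprn_ge0.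
lra.
Qed.

End Difference.

End Estimates.

(** * From extended-real norms to pointwise bounds *)

Section RoughIntegral.
Context {R : realType} {I J : finType}.
Variables (X : rough R I) (Y : ctriple R I (I * J)%type).

Lemma germ_sumE (s t : R) (p : seq R) :
  germ_sum X Y s t p = rsum (germ X Y) s p.
Proof.
rewrite /germ_sum; elim: p s => [|x p IH] s /=; first by rewrite big_geq.
by rewrite big_nat_recl //= IH.
Qed.

Lemma is_rough_integralP (s t : R) (z : euc R J) :
  is_rough_integral X Y s t z <-> sewn (germ X Y) s t z.
Proof.
split=> h eps eps0; have [d d0 hd] := h eps eps0; exists d => // p ps gp.
  rewrite -(germ_sumE s t); apply: hd => // l lp.
  exact: (pathP t gp).
rewrite germ_sumE; apply: hd => //.
by apply/(pathP t) => l; exact: gp.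
Qed.

(** Once a limit exists, [xget] selects one, so its default value 0 does not intervene. *)
Lemma rough_integralP (s t : R) : (exists z, sewn (germ X Y) s t z) ->
  sewn (germ X Y) s t (rough_integral X Y s t).
Proof.
move=> [z /is_rough_integralP hz]; apply/is_rough_integralP.
by have := xgetPex (0 : euc R J) (ex_intro [set z | is_rough_integral X Y s t z] z hz).
Qed.

End RoughIntegral.

(** * Pointwise bounds extracted from the norms and distances of the data *)

Section DataBounds.
Context {R : realType} {I J : finType}.
Variables (alpha T : R).
Hypothesis T_gt0 : 0 < T.
Implicit Types (X : rough R I) (Y : ctriple R I (I * J)%type).

Lemma holder_ub (L : finType) (c : R) (psi : R -> R -> euc R L) :
  incr_le alpha T 1 c psi -> (holder2 T alpha psi <= c%:E)%E.
Proof. by move=> /holder2_ub; rewrite mulr1n mul1r. Qed.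

Lemma holder_incr_le (L : finType) (c : R) (psi : R -> R -> euc R L) :
  0 <= c -> (forall s, 0 <= s -> s <= T -> psi s s = 0) ->
  (holder2 T alpha psi <= c%:E)%E -> incr_le alpha T 1 c psi.
Proof.
by move=> c0 psi0 h; apply: holder2_incr_le; rewrite ?mulr1n ?mul1r.
Qed.

Lemma lee_summands2 (a b x : \bar R) : (0 <= a -> 0 <= b -> a + b <= x ->
  a <= x /\ b <= x)%E.
Proof.
by move=> a0 b0 abx; split; apply: le_trans abx; rewrite ?leeDl ?leeDr.
Qed.

Lemma lee_summands3 (a b c x : \bar R) : (0 <= a -> 0 <= b -> 0 <= c ->
  a + b + c <= x -> [/\ a <= x, b <= x & c <= x])%E.
Proof.
move=> a0 b0 c0 /(lee_summands2 (adde_ge0 a0 b0) c0) [].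
by move=> /(lee_summands2 a0 b0) [].
Qed.

Lemma bounded_data_by (M K : R) X Y :
  M <= K -> 0 <= K -> bounded_data alpha T M X Y -> bounded_by alpha T K X Y.
Proof.
move=> MK K0 [[_ chen _] _ Ynorm Xnorm].
have {}Xnorm := le_trans Xnorm (MK : (M%:E <= K%:E)%E).
have {}Ynorm := le_trans Ynorm (MK : (M%:E <= K%:E)%E).
have [x1 x2 x3] := lee_summands3 (holder2_ge0 _ _ T_gt0)
  (holder2_ge0 _ _ T_gt0) (holder2_ge0 _ _ T_gt0) Xnorm.
have c0 : (0 <= ctrl_norm alpha T X Y)%E by rewrite !adde_ge0 ?holder2_ge0.
have e0 (L : finType) (v : euc R L) : (0 <= (enorm v)%:E)%E.
  by rewrite lee_fin enorm_ge0.
have [yi yn] := lee_summands2 (adde_ge0 (adde_ge0 (e0 _ _) (e0 _ _)) (e0 _ _))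
  c0 Ynorm.
have [y0 y1 y2] := lee_summands3 (e0 _ _) (e0 _ _) (e0 _ _) yi.
have [y3 y4 y5] := lee_summands3 (holder2_ge0 _ _ T_gt0)
  (holder2_ge0 _ _ T_gt0) (holder2_ge0 _ _ T_gt0) yn.
split=> //.
- apply: holder_incr_le => // s; exact: (lev1_diag chen).
- apply: holder2_incr_le => // s; exact: (lev2_diag chen).
- apply: holder2_incr_le => // s; exact: (lev3_diag chen).
- by apply: holder_incr_le => // s _ _; rewrite subrr.
- apply: holder2_incr_le => // s s0 sT; exact: (ssharp_diag chen).
- apply: holder2_incr_le => // s s0 sT; exact: (sharp_diag chen).
Qed.

Lemma rough_dist_ge0 X X' : (0 <= rough_dist alpha T X X')%E.
Proof. by rewrite !adde_ge0 ?holder2_ge0. Qed.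

Lemma ctrl_dist_ge0 (L : finType) X X' (Y Y' : ctriple R I L) :
  (0 <= ctrl_dist alpha T X X' Y Y')%E.
Proof. by rewrite !adde_ge0 ?holder2_ge0. Qed.

Lemma data_dist_ge0 X X' Y Y' : (0 <= data_dist alpha T X X' Y Y')%E.
Proof.
rewrite /data_dist; apply: adde_ge0.
  by rewrite !adde_ge0 ?lee_fin ?enorm_ge0 ?holder2_ge0.
by rewrite mule_ge0 ?lee_fin ?powR_ge0 ?ctrl_dist_ge0.
Qed.

(** The last summand of [data_dist] gives T^alpha * [ctrl_dist] <= r, hence the choice of d; then h
    <= T yields d * h^alpha <= r. *)
Lemma data_dist_close (K r : R) X X' Y Y' : 0 < alpha ->
  bounded_by alpha T K X Y -> bounded_by alpha T K X' Y' ->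
  0 <= r -> (data_dist alpha T X X' Y Y' <= r%:E)%E ->
  close_by alpha T r (r / T `^ alpha) X X' Y Y'.
Proof.
move=> alpha0 bXY bXY' r0.
have Ta : 0 < T `^ alpha by rewrite powR_gt0.
have chen := bb_chen bXY; have chen' := bb_chen bXY'.
have e0 (L : finType) (v : euc R L) : (0 <= (enorm v)%:E)%E.
  by rewrite lee_fin enorm_ge0.
have d0 : 0 <= r / T `^ alpha by rewrite divr_ge0 // ltW.
rewrite /data_dist => /(lee_summands2 _ _) [||].
- by rewrite !adde_ge0 ?holder2_ge0.
- by rewrite mule_ge0 ?lee_fin ?(ltW Ta) ?ctrl_dist_ge0.
move=> /(lee_summands3 _ _ _) [|||+ y1 y2]; rewrite ?e0 //.
  by rewrite !adde_ge0 ?holder2_ge0.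
move=> /(lee_summands2 (rough_dist_ge0 _ _) (e0 _ _)) [rho y0] yd.
have {}yd : (ctrl_dist alpha T X X' Y Y' <= (r / T `^ alpha)%:E)%E.
  by rewrite mulrC EFinM lee_pdivlMl.
have [x1 x2 x3] := lee_summands3 (holder2_ge0 _ _ T_gt0)
  (holder2_ge0 _ _ T_gt0) (holder2_ge0 _ _ T_gt0) rho.
have [y3 y4 y5] := lee_summands3 (holder2_ge0 _ _ T_gt0)
  (holder2_ge0 _ _ T_gt0) (holder2_ge0 _ _ T_gt0) yd.
split=> //.
- move=> h h0 hT; rewrite mulrAC ler_pdivrMr // ler_wpM2l //.
  by apply: ge0_ler_powR; rewrite ?nnegrE ?(ltW alpha0) ?(ltW T_gt0).
- apply: holder_incr_le => // s s0 sT.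
  by rewrite (lev1_diag chen) ?(lev1_diag chen') ?subrr.
- apply: holder2_incr_le => // s s0 sT.
  by rewrite (lev2_diag chen) ?(lev2_diag chen') ?subrr.
- apply: holder2_incr_le => // s s0 sT.
  by rewrite (lev3_diag chen) ?(lev3_diag chen') ?subrr.
- by apply: holder_incr_le => // s _ _; rewrite subrr.
- apply: holder2_incr_le => // s s0 sT.
  by rewrite (ssharp_diag chen) ?(ssharp_diag chen') ?subrr.
- apply: holder2_incr_le => // s s0 sT.
  by rewrite (sharp_diag chen) ?(sharp_diag chen') ?subrr.
Qed.

(** Reduction to a finite data distance: for x = +oo the right-hand side is +oo because C > 0. *)
Lemma lee_scale_fin (C : R) (x y : \bar R) : 0 < C -> (0 <= x)%E ->
  (forall r : R, 0 <= r -> (x <= r%:E)%E -> (y <= (C * r)%:E)%E) ->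
  (y <= C%:E * x)%E.
Proof.
move=> C0; case: x => [r||//] x0 h; first by rewrite -EFinM; apply: h.
by rewrite gt0_muley ?lte_fin // leey.
Qed.

End DataBounds.

(** * The continuity estimates for the rough integral *)

Unset Implicit Arguments.

Theorem proposition2p6 (R : realType) (alpha M T0 : R)
    (alpha_gt : 4^-1 < alpha) (alpha_lt : alpha < 3^-1) :
  exists C : R, 0 < C /\
  forall (n m : nat) (T : R) (X X' : rough R 'I_n)
    (Y Y' : ctriple R 'I_n ('I_n * 'I_m)%type),
  0 < T -> T <= T0 ->
  bounded_data alpha T M X Y ->
  bounded_data alpha T M X' Y' ->
  let Z := integral_triple X Y in
  let Z' := integral_triple X' Y' in
  [/\ (forall t, 0 <= t <= T ->
         is_rough_integral X Y 0 t (cp0 Z t) /\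
         is_rough_integral X' Y' 0 t (cp0 Z' t)),
      controlled alpha T X Z /\ controlled alpha T X' Z',
      (ctrl_dist alpha T X X' Z Z' <= C%:E * data_dist alpha T X X' Y Y')%E
    & (holder T alpha (fun t => cp0 Z t - cp0 Z' t)%R
         <= C%:E * data_dist alpha T X X' Y Y')%E].
Proof.
have alpha0 : 0 < alpha by lra.
have c0 : 0 < sew_const (4%:R * alpha) by apply: sew_const_gt0; lra.
(* The summands ensure 1 <= K, M <= K, h^alpha <= K for h <= T <= T0, and the bound on the sewing
   constant. None depends on T or on the dimensions. *)
pose K0 := 1 + `|M| + T0 `^ alpha + sew_const (4%:R * alpha).
have [K KE] : exists K, K = K0 by exists K0.
have M0 := normr_ge0 M; have MM := ler_norm M; have Ta0 := powR_ge0 T0 alpha.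
rewrite /K0 {K0} in KE.
have K1 : 1 <= K by lra.
have K_ge0 : 0 <= K by lra.
have cK : sew_const (4%:R * alpha) <= K by lra.
(* 81 = 3 * 27 covers the three terms of [ctrl_dist], each at most 27 * K^5 * r, and also the bound
   54 * K^7 * r for Z - Z'. *)
exists (81 * K ^+ 7); split; first by rewrite mulr_gt0 ?exprn_gt0 //; lra.
move=> n m T X X' Y Y' T_gt0 TT0 dXY dXY' Z Z'.
have C0 : 0 < 81 * K ^+ 7 by rewrite mulr_gt0 ?exprn_gt0 //; lra.
have powK h : 0 <= h -> h <= T -> h `^ alpha <= K.
  move=> h0 hT; have : h `^ alpha <= T0 `^ alpha.
    by apply: ge0_ler_powR; rewrite ?nnegrE; lra.
  by move: (h `^ alpha) => q; lra.
have MK : M <= K by lra.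
have bXY := bounded_data_by T_gt0 MK K_ge0 dXY.
have bXY' := bounded_data_by T_gt0 MK K_ge0 dXY'.
have zs t : 0 <= t -> t <= T -> sewn (germ X Y) 0 t (cp0 Z t).
  by move=> t0 tT; apply/rough_integralP/(germ_sewn_exists alpha_gt K1 bXY t0 tT).
have zs' t : 0 <= t -> t <= T -> sewn (germ X' Y') 0 t (cp0 Z' t).
  by move=> t0 tT; apply/rough_integralP/(germ_sewn_exists alpha_gt K1 bXY' t0 tT).
have ctrlZ (X1 : rough R 'I_n) (Y1 : ctriple R 'I_n ('I_n * 'I_m)%type) :
    bounded_data alpha T M X1 Y1 -> controlled alpha T X1 (integral_triple X1 Y1).
  move=> dXY1; have bXY1 := bounded_data_by T_gt0 MK K_ge0 dXY1.
  have zs1 t : 0 <= t -> t <= T ->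
      sewn (germ X1 Y1) 0 t (rough_integral X1 Y1 0 t).
    move=> t0 tT.
    by apply/rough_integralP/(germ_sewn_exists alpha_gt K1 bXY1 t0 tT).
  (* The derivative components of [Z] are [cp0 Y1] and [cp1 Y1], Hölder by assumption; the a priori
     estimates give the other three seminorms. *)
  have [_ [[y0 y1 _] _ _] _ _] := dXY1.
  split; first split=> //.
  - apply: le_lt_trans (ltry _).
    exact: holder_ub (integral_incr_le alpha_gt K1 powK cK bXY1 zs1).
  - apply: le_lt_trans (ltry _).
    exact: holder2_ub (integral_sharp_le alpha_gt K1 powK cK bXY1 zs1).
  - apply: le_lt_trans (ltry _).
    exact: holder2_ub (integral_ssharp_le K1 powK bXY1 _).
split.
- by move=> t /andP[t0 tT]; split; apply/is_rough_integralP; [exact: zs|exact: zs'].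
- by split; exact: ctrlZ.
- apply: lee_scale_fin => //; first exact: data_dist_ge0.
  move=> r r0 /(data_dist_close T_gt0 alpha0 bXY bXY' r0) cl.
  apply: le_trans (leeD (leeD
    (holder_ub (integral_cp2_close K1 powK bXY bXY' cl))
    (holder2_ub (integral_sharp_close alpha_gt K1 powK cK bXY bXY' cl zs zs')))
    (holder2_ub (integral_ssharp_close K1 powK bXY bXY' cl _ _))) _.
  have h : K ^+ 5 * r <= K ^+ 7 * r by rewrite ler_wpM2r // ler_weXn2l.
  by rewrite -!EFinD lee_fin; lra.
- apply: lee_scale_fin => //; first exact: data_dist_ge0.
  move=> r r0 /(data_dist_close T_gt0 alpha0 bXY bXY' r0) cl.
  apply: le_trans
    (holder_ub (integral_close alpha_gt K1 powK cK bXY bXY' cl zs zs')) _.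
  have h : 0 <= K ^+ 7 * r by rewrite mulr_ge0 ?exprn_ge0.
  by rewrite lee_fin; lra.
Qed.
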